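(* Let $k\ge 1$ and $n\ge 2k+3$. Then $\mathrm{Grob}_k(n)\subset\mathbb{R}^{\binom{[n]}{2}}$ is a simplicial cone with a lineality space of dimension $n$ (that is, it is the sum of an $n$-dimensional linear subspace and a cone that is simplicial modulo that subspace). More precisely: (1) $\mathrm{Grob}_k(n)$ is generated by the following vectors and lines: (a) (lineality space) for each $i\in[n]$, the line spanned by the indicator vector of the set $\{\{i,j\}: j\in[n]\setminus\{i\}\}$; (b) (''short'' generators) for each $\{i,j\}\in\binom{[n]}{2}$ with $1\le |i-j|\le k$, the negative $-V_{i,j}$ of the standard basis vector corresponding to $\{i,j\}$; (c) (''long'' generators) for each $\{i,j\}\in\binom{[n]}{2}$ with $|i-j|\ge k+2$, the ray $W_{i,j}$ of $\mathrm{FP}_n$ corresponding to $\{i,j\}$. (2) An irredundant facet description of $\mathrm{Grob}_k(n)$ is given by the following $\binom{n}{2}-n$ inequalities, where $s_{a,b}(v):=v_{a,b}+v_{a+1,b+1}-v_{a,b+1}-v_{a+1,b}$: (a) (''long'' inequalities) for each $\{i,j\}\in\binom{[n]}{2}$ with $|i-j|\ge k+1$, the inequality $s_{i,j}(v)\ge 0$; (b) (''short'' inequalities) for each $\{i,j\}\in\binom{[n]}{2}$ with $2\le|i-j|\le k$, the inequality $\sum s_{i',j'}(v)\ge 0$, where the sum runs over all $\{i',j'\}\in\binom{[n]}{2}$ with $|i'-j'|\le k+1$ and with $\{i,j\}$ contained in the short side of $\{i',j'\}$. In particular, $\mathrm{FP}_n\subset \mathrm{Grob}_k(n)$.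
   Context: Here $[n]=\{1,\dots,n\}$ is identified with $\mathbb{Z}/n$, indices are taken modulo $n$, and $|i-j|$ denotes cyclic distance, i.e. the minimum of the two residues of $i-j$ and $j-i$ in $\{0,\dots,n-1\}$. Vectors $v\in\mathbb{R}^{\binom{[n]}{2}}$ have coordinates $v_{i,j}=v_{j,i}$ indexed by two-element subsets of $[n]$; $V_{i,j}$ is the standard basis vector. Edges $\{i,j\},\{i',j'\}$ with $i<j$, $i'<j'$ cross if $i<i'<j<j'$ or $i'<i<j'<j$. A $(k+1)$-crossing is a set of $k+1$ mutually crossing edges. Each $U\subset[n]$ with $|U|=2k+2$ has exactly one perfect matching that is a $(k+1)$-crossing. The Pfaffian of degree $k+1$ of $U$ is $\sum_E(-1)^{\mathrm{cr}(E)}\prod_{\{i,j\}\in E}x_{i,j}$, over all perfect matchings $E$ of $U$, where $\mathrm{cr}(E)$ is the number of crossing pairs in $E$. $\mathrm{Grob}_k(n)$ is the set of $v\in\mathbb{R}^{\binom{[n]}{2}}$ such that, for every $U\subset[n]$ of size $2k+2$, the maximum of $\sum_{\{i,j\}\in E}v_{i,j}$ over perfect matchings $E$ of $U$ is attained at (possibly among others) the $(k+1)$-crossing of $U$. $\mathrm{FP}_n$ is the set of $v$ with $v_{a,b}+v_{a',b'}\ge\max\{v_{a,a'}+v_{b,b'},\,v_{a,b'}+v_{a',b}\}$ for all $1\le a<a'<b<b'\le n$. It is irredundantly described by the linearly independent inequalities $s_{a,b}(v)\ge0$ for $\{a,b\}$ with $|a-b|>1$. Its ray corresponding to $\{i,j\}$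 ($|i-j|>1$) is, modulo the lineality space, the one at which all these inequalities except that of $\{i,j\}$ are equalities; it is represented by the vector $W_{i,j}$ whose $\{a,b\}$-coordinate is $1$ if exactly one of $a,b$ lies in the cyclic interval $\{i+1,i+2,\dots,j\}$ and is $0$ otherwise. For $|i'-j'|\le k+1$, name the endpoints so that $j'=i'+|i'-j'|$ (mod $n$); the short side of $\{i',j'\}$ is the cyclic interval $\{i',i'+1,\dots,j'\}$. *)

(* Defs.v *)
From HB Require Import structures.
From mathcomp Require Import all_boot all_order all_algebra.

Set Implicit Arguments.
Unset Strict Implicit.
Unset Printing Implicit Defensive.

Import Order.TTheory GRing.Theory Num.Theory.

Local Open Scope ring_scope.

Section Cones.
Variables (R : realFieldType) (V : vectType R).
Implicit Types (C : V -> Prop) (L : {vspace V}) (rays : seq V).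

Definition in_cone rays (v : V) : Prop :=
  exists c : 'I_(size rays) -> R,
    (forall i, 0 <= c i) /\ v = \sum_i c i *: rays`_i.

Definition independent_modulo L rays : Prop :=
  forall c : 'I_(size rays) -> R,
    \sum_i c i *: rays`_i \in L -> forall i, c i = 0.

Definition lineality_space C L : Prop :=
  forall v, v \in L <-> C v /\ C (- v).

Definition simplicial_cone C L rays : Prop :=
  [/\ lineality_space C L,
      independent_modulo L rays
    & forall v, C v <-> exists2 l, l \in L & in_cone rays (v - l)].

Definition linear_hull (A : V -> Prop) (U : {vspace V}) : Prop :=
  (forall v, A v -> v \in U) /\
  (forall U' : {vspace V}, (forall v, A v -> v \in U') -> (U <= U')%VS).

(* Codimension is measured by linear hulls, which agree with affine hulls for
   sets containing 0. *)
Definition defines_facet C (f : V -> R) : Prop :=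
  [/\ exists v, C v /\ f v != 0,
      forall v, C v -> 0 <= f v
    & exists U W, [/\ linear_hull C U,
                      linear_hull (fun v => C v /\ f v = 0) W
                    & \dim U = (\dim W).+1]].

(* The members of [fs] are meant to be linear forms. *)
Definition irredundant_facet_description C (fs : seq (V -> R)) : Prop :=
  let f (i : 'I_(size fs)) := nth (fun=> 0) fs i in
  [/\ forall v, C v <-> (forall i, 0 <= f i v),
      forall i, exists v, (forall j, j != i -> 0 <= f j v) /\ ~ C v
    & forall i, defines_facet C (f i)].

End Cones.

(* The set [n] is 'I_n = {0, ..., n-1}, so every label is shifted by one. *)

Section CyclicIndices.
Variable n : nat.
Implicit Types i j : 'I_n.

(* The residue of j - i modulo n. *)
Definition gap i j : nat := (j + n - i) %% n.

Definition cdist i j : nat := minn (gap i j) (gap j i).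

(* The cyclic interval {i, i+1, ..., j}. *)
Definition cyc_interval i j : {set 'I_n} := [set x | (gap i x <= gap i j)%N].

(* A two-element subset {i, j} is encoded by the pair (i, j) with i < j. *)
Definition edge : Type := {p : 'I_n * 'I_n | (p.1 < p.2)%N}.

Definition fst_end (e : edge) : 'I_n := (val e).1.
Definition snd_end (e : edge) : 'I_n := (val e).2.
Definition ends (e : edge) : {set 'I_n} := [set fst_end e; snd_end e].
Definition edist (e : edge) : nat := cdist (fst_end e) (snd_end e).

(* Only used when edist e < n / 2, where exactly one naming i, j of the two
   endpoints satisfies j = i + edist e modulo n. *)
Definition short_side (e : edge) : {set 'I_n} :=
  if gap (fst_end e) (snd_end e) == edist e
  then cyc_interval (fst_end e) (snd_end e)
  else cyc_interval (snd_end e) (fst_end e).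

Definition crosses (e f : edge) : bool :=
  [&& fst_end e < fst_end f, fst_end f < snd_end e & snd_end e < snd_end f]%N
  || [&& fst_end f < fst_end e, fst_end e < snd_end f
       & snd_end f < snd_end e]%N.

Definition is_crossing (m : nat) (E : {set edge}) : Prop :=
  #|E| = m /\ {in E &, forall e f, e != f -> crosses e f}.

Definition perfect_matching (U : {set 'I_n}) (E : {set edge}) : bool :=
  partition [set ends e | e in E] U.

End CyclicIndices.

Section Grob.
Variables (R : realFieldType) (n : nat).
Implicit Types (v : {ffun edge n -> R^o}) (e : edge n) (i j a b : 'I_n).

(* v_{i,j} = v_{j,i}; the value for i = j is a dummy. *)
Definition entry v i j : R :=
  oapp v 0 (insub (if (i < j)%N then (i, j) else (j, i)) : option (edge n)).

Definition weight v (E : {set edge n}) : R := \sum_(e in E) v e.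

Definition Grob (k : nat) v : Prop :=
  forall U : {set 'I_n}, #|U| = (2 * k + 2)%N ->
    exists X, [/\ perfect_matching U X, is_crossing k.+1 X
      & forall E, perfect_matching U E -> weight v E <= weight v X].

Definition FP v : Prop :=
  forall a a' b b', (a < a')%N -> (a' < b)%N -> (b < b')%N ->
    Num.max (entry v a a' + entry v b b') (entry v a b' + entry v a' b)
      <= entry v a b + entry v a' b'.

Definition s_form a b v : R :=
  entry v a b + entry v (ordS a) (ordS b)
    - entry v a (ordS b) - entry v (ordS a) b.

Definition s_edge e v : R := s_form (fst_end e) (snd_end e) v.

(* w represents the ray of FP corresponding to e: it lies in FP but not in its
   lineality space, and all inequalities but that of e are tight at w. *)
Definition FP_ray e (w : {ffun edge n -> R^o}) : Prop :=
  [/\ FP w, ~ FP (- w)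
    & forall f, (1 < edist f)%N -> f != e -> s_edge f w = 0].

Definition star_vec i : {ffun edge n -> R^o} := [ffun e => (i \in ends e)%:R].

Definition basis_vec e : {ffun edge n -> R^o} := [ffun f => (f == e)%:R].

Definition W_vec e : {ffun edge n -> R^o} :=
  let S := cyc_interval (ordS (fst_end e)) (snd_end e) in
  [ffun f => ((fst_end f \in S) != (snd_end f \in S))%:R].

Definition Grob_lines : seq {ffun edge n -> R^o} :=
  [seq star_vec i | i <- enum 'I_n].

Definition Grob_rays (k : nat) : seq {ffun edge n -> R^o} :=
  [seq - basis_vec e | e <- enum {: edge n} & (1 <= edist e <= k)%N] ++
  [seq W_vec e | e <- enum {: edge n} & (k + 2 <= edist e)%N].

Definition short_form (k : nat) e v : R :=
  \sum_(f : edge n | (edist f <= k + 1)%N && (ends e \subset short_side f))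
    s_edge f v.

Definition Grob_ineqs (k : nat) : seq ({ffun edge n -> R^o} -> R) :=
  [seq s_edge e | e <- enum {: edge n} & (k + 1 <= edist e)%N] ++
  [seq short_form k e | e <- enum {: edge n} & (2 <= edist e <= k)%N].

End Grob.

(* Main.v *)
(** A set U of 2k+2 points has a unique (k+1)-crossing, so Grob_k(n) is a polyhedral cone.
    Comparing the crossing of U = {a+t, a+g+t : t <= k} with the matching
    a+t -- a+g+t+1 (t < m), a+m -- a+g, a+t -- a+g+t (t > m) yields a valid
    inequality.  For m = 1 it is s_{a,a+g} >= 0, and for g = k+1 the telescoping
    sum over the triangle of s_{a+p,a+k+1+q}, q <= p < m, identifies it with a
    short inequality, in which a+m -- a+k+1 is the only edge of length <= k.
    Hence the generators -V_h and W_h form, up to positive scalars, a basis dual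
    to the inequalities modulo the span of the star vectors: the inequalities cut
    out the simplicial cone spanned by the generators.  Conversely the generators
    lie in Grob_k(n): every edge of a crossing has length > k, and for the cut
    vectors W_h a crossing cuts as many edges as any matching. *)

Require Import Defs.
From HB Require Import structures.
From mathcomp Require Import all_boot all_order all_algebra.
From mathcomp Require Import zify ring lra.

Set Implicit Arguments.
Unset Strict Implicit.
Unset Printing Implicit Defensive.

Import Order.TTheory GRing.Theory Num.Theory.

Local Open Scope ring_scope.

(** * Cones with a dual basis *)

Lemma linear_formN (R : realFieldType) (V : vectType R) (f : V -> R^o) v :
  linear f -> f (- v) = - f v.
Proof.
move=> lf; have f0 : f 0 = 0.
  have := lf 1 0 0; rewrite scaler0 addr0 scale1r => /eqP.
  by rewrite -subr_eq subrr eq_sym => /eqP.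
by rewrite -scaleN1r -[_ *: v]addr0 lf f0 addr0 scaleN1r.
Qed.

Section DualCone.
Variables (R : realFieldType) (V : vectType R) (L : {vspace V}) (m : nat).
Variables (f : 'I_m -> V -> R^o) (r : 'I_m -> V).
Hypothesis linf : forall i, linear (f i).
Hypothesis fL : forall i v, v \in L -> f i v = 0.
Hypothesis dimV : (\dim L + m = \dim {:V})%N.
Hypothesis fr0 : forall i j, j != i -> f i (r j) = 0.
Hypothesis fr_gt0 : forall i, 0 < f i (r i).

(** All forms are bundled into one linear map to row vectors, so that rank-nullity applies to their
    common kernel. *)
Definition eval_forms (v : V) : 'rV[R]_m := \row_i f i v.

Lemma eval_forms_linear : linear eval_forms.
Proof. by move=> a u v; apply/rowP=> i; rewrite !mxE linf. Qed.

HB.instance Definition _ :=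
  GRing.isLinear.Build R V 'rV[R]_m _ eval_forms eval_forms_linear.

Lemma form_sum i (I : finType) (c : I -> R) (w : I -> V) :
  f i (\sum_j c j *: w j) = \sum_j c j * f i (w j).
Proof.
transitivity (eval_forms (\sum_j c j *: w j) 0 i); first by rewrite mxE.
by rewrite linear_sum summxE; apply: eq_bigr => j _; rewrite linearZ !mxE.
Qed.

Lemma formB i u v : f i (u - v) = f i u - f i v.
Proof.
transitivity (eval_forms (u - v) 0 i); first by rewrite mxE.
by rewrite linearB !mxE.
Qed.

Lemma form_dual_sum i (c : 'I_m -> R) :
  f i (\sum_j c j *: r j) = c i * f i (r i).
Proof.
rewrite form_sum (bigD1 i) //= big1 ?addr0 // => j ji.
by rewrite fr0 // mulr0.
Qed.

(** [L] lies in the kernel of [eval_forms]. That map is onto, since the suitably scaled [r j] reach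
    every row vector, so by [dimV] its kernel has the dimension of [L] and equals it. *)
Lemma common_kernel v : (forall i, f i v = 0) -> v \in L.
Proof.
move=> fv0.
have LK : (L <= lker (linfun eval_forms))%VS.
  apply/subvP=> w wL; rewrite memv_ker lfunE /=.
  by apply/eqP/rowP=> i; rewrite !mxE fL.
have im : limg (linfun eval_forms) = fullv.
  apply/vspaceP=> w; rewrite memvf.
  have -> : w = linfun eval_forms (\sum_j (w 0 j / f j (r j)) *: r j).
    apply/rowP=> i; rewrite lfunE mxE form_dual_sum divfK //.
    by rewrite gt_eqF.
  exact: memv_img (memvf _).
have := limg_ker_dim (linfun eval_forms) fullv.
rewrite capfv im -dimV dimvf dim_matrix mul1r => /eqP.
rewrite eqn_add2r => /eqP dimK.
have -> : L = lker (linfun eval_forms) by apply/eqP; rewrite eqEdim LK dimK /=.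
by rewrite memv_ker lfunE /=; apply/eqP/rowP=> i; rewrite !mxE.
Qed.

(** By duality [f i v / f i (r i)] is the only possible coefficient of [r i]; after subtracting
    these terms every form vanishes. *)
Lemma dual_decomposition v :
  v - \sum_i (f i v / f i (r i)) *: r i \in L.
Proof.
apply: common_kernel => i; rewrite formB form_dual_sum divfK ?subrr //.
by rewrite gt_eqF.
Qed.

Variable C : V -> Prop.
Hypothesis CE : forall v, C v <-> forall i, 0 <= f i v.

Lemma dual_cone_generator i : C (r i).
Proof.
apply/CE=> j; have [->|ij] := eqVneq i j; first exact: ltW.
by rewrite fr0.
Qed.

Lemma dual_cone_contains_lines l : l \in L -> C l.
Proof. by move=> lL; apply/CE=> i; rewrite fL. Qed.

Lemma dual_cone_lineality : lineality_space C L.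
Proof.
move=> v; split=> [vL|[/CE Cv /CE CNv]].
  by split; apply: dual_cone_contains_lines; rewrite ?rpredN.
apply: common_kernel => i; apply: le_anti; rewrite Cv andbT.
by have := CNv i; rewrite (linear_formN _ (linf _)) oppr_ge0.
Qed.

Lemma dual_cone_independent (c : 'I_m -> R) :
  \sum_i c i *: r i \in L -> forall i, c i = 0.
Proof.
move=> cL i; have := fL i cL; rewrite form_dual_sum => /eqP.
by rewrite mulf_eq0 (gt_eqF (fr_gt0 i)) orbF => /eqP.
Qed.

(** The coefficients of the dual decomposition are nonnegative exactly when all forms are
    nonnegative at [v]. *)
Lemma dual_cone_generated v :
  C v <-> exists2 l, l \in L
    & exists c : 'I_m -> R, (forall i, 0 <= c i) /\ v - l = \sum_i c i *: r i.
Proof.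
split=> [/CE Cv|[l lL [c [c_ge0 vl]]]].
  exists (v - \sum_i (f i v / f i (r i)) *: r i); first exact: dual_decomposition.
  exists (fun i => f i v / f i (r i)); split; last by rewrite subKr.
  by move=> i; rewrite divr_ge0 // ltW.
apply/CE=> i; rewrite -[v](subrK l) vl -[l]opprK formB
  (linear_formN _ (linf i)) (fL _ lL) !oppr0 addr0.
by rewrite form_dual_sum mulr_ge0 // ltW.
Qed.

(** [C] contains [L] and all [r j], hence spans [V]. The face [f i = 0] contains [L] and all [r j]
    with [j != i], hence spans the kernel of [f i], a hyperplane because [f i (r i) > 0]. *)
Lemma dual_cone_facet i : defines_facet C (f i).
Proof.
split; first by exists (r i); split; [exact: dual_cone_generator | rewrite gt_eqF].
  by move=> v /CE.
pose Li := GRing.isLinear.Build R V R^o _ (f i) (@linf i).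
pose fi : {linear V -> R^o} := HB.pack (f i) Li.
exists fullv, (lker (linfun fi)).
have LC := dual_cone_contains_lines.
split.
- split=> [v _|U' CU']; first exact: memvf.
  apply/subvP=> v _; rewrite -[v](subrK (\sum_i (f i v / f i (r i)) *: r i)).
  apply: rpredD; first by apply/CU'/LC/dual_decomposition.
  by apply: rpred_sum => j _; apply/rpredZ/CU'/dual_cone_generator.
- split=> [v [_ fv0]|U' CU']; first by rewrite memv_ker lfunE /= fv0.
  apply/subvP=> v; rewrite memv_ker lfunE /= => /eqP fv0.
  rewrite -[v](subrK (\sum_i (f i v / f i (r i)) *: r i)).
  apply: rpredD.
    have dL := dual_decomposition v.
    by apply: CU'; split; [exact: LC | exact: fL].
  apply: rpred_sum => j _; have [->|ji] := eqVneq j i.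
    by rewrite fv0 mul0r scale0r rpred0.
  by apply/rpredZ/CU'; split; [exact: dual_cone_generator | exact: fr0].
have := limg_ker_dim (linfun fi) fullv.
rewrite capfv => <-.
suff -> : limg (linfun fi) = fullv by rewrite dimvf /dim /= addn1.
apply/vspaceP=> w; rewrite memvf.
have -> : w = linfun fi ((w / f i (r i)) *: r i).
  by rewrite lfunE linearZ /= /GRing.scale /= divfK // gt_eqF.
exact: memv_img (memvf _).
Qed.

Lemma dual_cone_irredundant i :
  exists v, (forall j, j != i -> 0 <= f j v) /\ ~ C v.
Proof.
(* The vector [- r i] violates the [i]-th inequality only. *)
exists (- r i); split=> [j ji|/CE CN].
  by rewrite (linear_formN _ (linf _)) fr0 ?oppr0 // eq_sym.
by have := CN i; rewrite (linear_formN _ (linf _)) oppr_ge0 leNgt fr_gt0.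
Qed.

Lemma dual_cone_ineqs_irredundant (fs : seq (V -> R)) :
    size fs = m ->
    (forall (i : 'I_(size fs)) (j : 'I_m), i = j :> nat ->
       nth (fun=> 0) fs i = f j) ->
  irredundant_facet_description C fs.
Proof.
move=> sz_fs fsE; split=> [v|i|i].
- rewrite CE; split=> Cv i.
    by rewrite (fsE i (cast_ord sz_fs i)).
  by rewrite -(fsE (cast_ord (esym sz_fs) i) i).
- have [v [v_ge0 nCv]] := dual_cone_irredundant (cast_ord sz_fs i).
  exists v; split=> // j ji; rewrite (fsE j (cast_ord sz_fs j)) //.
  by apply: v_ge0; apply: contra_neq ji => /cast_ord_inj.
rewrite (fsE i (cast_ord sz_fs i)) //; exact: dual_cone_facet.
Qed.

(** The bijection [h] allows the rays to be listed in an order different from that of the forms dual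
    to them. *)
Lemma dual_cone_simplicial (rays : seq V) (h : 'I_m -> 'I_(size rays)) :
  bijective h -> (forall i, rays`_(h i) = r i) -> simplicial_cone C L rays.
Proof.
move=> hbij raysE.
have sumE (c : 'I_(size rays) -> R) :
    \sum_i c i *: rays`_i = \sum_i c (h i) *: r i.
  rewrite (reindex h) /=; last exact: onW_bij.
  by apply: eq_bigr=> i _; rewrite raysE.
case: (hbij) => h' hK h'K.
split; first exact: dual_cone_lineality.
  by move=> c; rewrite sumE => /dual_cone_independent c0 i; rewrite -[i]h'K c0.
move=> v; rewrite dual_cone_generated.
split=> -[l lL [c [c_ge0 vl]]]; exists l => //.
  exists (c \o h'); split=> [i|]; first exact: c_ge0.
  by rewrite sumE vl; apply: eq_bigr => i _; rewrite /= hK.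
by exists (c \o h); split=> [i|]; [exact: c_ge0 | rewrite vl sumE].
Qed.

End DualCone.

(** Passage from ordinal indices to lists of labels: [K] labels the inequalities, [J] the rays, and
    [s] sends an inequality to the ray dual to it. *)
Lemma labelled_dual_cone (R : realFieldType) (V : vectType R) (L : {vspace V})
    (T : eqType) (K J : seq T) (s : T -> T) (F : T -> V -> R^o) (r : T -> V)
    (C : V -> Prop) :
    {in K, forall e, linear (F e)} ->
    {in K, forall e l, l \in L -> F e l = 0} ->
    (\dim L + size K = \dim {:V})%N ->
    uniq K -> uniq J -> size J = size K -> {in K, forall e, s e \in J} ->
    {in K &, injective s} ->
    {in K & J, forall e h, h != s e -> F e (r h) = 0} ->
    {in K, forall e, 0 < F e (r (s e))} ->
    (forall v, C v <-> {in K, forall e, 0 <= F e v}) ->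
  simplicial_cone C L (map r J)
  /\ irredundant_facet_description C (map F K : seq (V -> R)).
Proof.
move=> linF FL dimV uK uJ szJK sJ s_inj Fr0 Fr_gt0 CE.
pose key := tnth (in_tuple K).
have keyK i : key i \in K by rewrite /key mem_tnth.
have key_inj : injective key by apply/tuple_uniqP.
have sz_fs : size (map F K : seq (V -> R)) = size K by rewrite size_map.
have linf i : linear (F (key i)) by exact: linF.
have fL i l : l \in L -> F (key i) l = 0 by exact: FL.
have fr0 i j : j != i -> F (key i) (r (s (key j))) = 0.
  move=> ji; apply: Fr0 => //; first exact: sJ.
  by apply: contra_neq ji => /s_inj/key_inj; apply.
have fr_gt0 i : 0 < F (key i) (r (s (key i))) by exact: Fr_gt0.
have CE' v : C v <-> forall i, 0 <= F (key i) v.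
  rewrite CE; split=> [Cv i|Cv e]; first exact: Cv.
  by move/(tnthP (in_tuple K))=> [i ->].
(* [h i] will be the position in [J] of the ray dual to the [i]-th inequality; it is bijective
   because it is injective and the two lists have equal length. *)
have hP i : (index (s (key i)) J < size (map r J))%N.
  by rewrite size_map index_mem sJ.
pose h i := Ordinal (hP i).
have h_inj : injective h.
  move=> i j [] /(congr1 (nth (s (key i)) J)).
  by rewrite !nth_index ?sJ // => /s_inj/key_inj; apply.
split.
  apply: (dual_cone_simplicial linf fL dimV fr0 fr_gt0 CE' (h := h)).
    by apply: inj_card_bij => //; rewrite !card_ord size_map szJK.
  move=> i; rewrite (nth_map (s (key i))) ?index_mem ?sJ //.
  by rewrite nth_index ?sJ.
apply: (dual_cone_ineqs_irredundant linf fL dimV fr0 fr_gt0 CE' sz_fs) => i j ij.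
by rewrite ij (nth_map (key j)) // [in RHS]/key [in RHS](tnth_nth (key j)).
Qed.

(** * Matchings and crossings *)

Section Edges.
Variable n : nat.
Implicit Types (i j x y : 'I_n) (e f : edge n) (U : {set 'I_n}).

(** The default [d] is returned only for [i = j], where there is no edge. *)
Definition mkedge (d : edge n) i j : edge n :=
  insubd d (if (i < j)%N then (i, j) else (j, i)).

Definition default_edge (n_gt1 : (1 < n)%N) : edge n :=
  exist _ (Ordinal (ltnW n_gt1), Ordinal n_gt1) isT.

Lemma fst_lt_snd e : (fst_end e < snd_end e)%N.
Proof. exact: (valP e). Qed.

Lemma edge_eq e f : fst_end e = fst_end f -> snd_end e = snd_end f -> e = f.
Proof.
rewrite /fst_end /snd_end => e1 e2; apply: val_inj.
by rewrite [val e]surjective_pairing [val f]surjective_pairing e1 e2.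
Qed.

Lemma set2_ends e i j : ends e = [set i; j] ->
  i = fst_end e /\ j = snd_end e \/ i = snd_end e /\ j = fst_end e.
Proof.
rewrite /ends => eij; have lt_e := fst_lt_snd e.
have : i \in [set fst_end e; snd_end e] by rewrite eij set21.
have : j \in [set fst_end e; snd_end e] by rewrite eij set22.
have : fst_end e \in [set i; j] by rewrite -eij set21.
have : snd_end e \in [set i; j] by rewrite -eij set22.
rewrite !inE => /orP[] /eqP si /orP[] /eqP fi /orP[] /eqP ji /orP[] /eqP ii;
  first [by left | by right | by move: lt_e; rewrite si fi ltnn
        | by move: lt_e; rewrite ?ii ?ji; subst; rewrite ?ltnn; auto].
Qed.

Lemma ends_inj : injective (@ends n).
Proof.
move=> e f; rewrite [ends f]/ends => /set2_ends[[f1 f2]|[f1 f2]].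
  exact: edge_eq.
by have := fst_lt_snd e; have := fst_lt_snd f; rewrite f1 f2 => *; lia.
Qed.

Lemma val_mkedge d i j :
  i != j -> val (mkedge d i j) = if (i < j)%N then (i, j) else (j, i).
Proof.
move=> ij; rewrite /mkedge insubdK //.
by case: (ltngtP i j) => //= eij; rewrite (val_inj eij) eqxx in ij.
Qed.

Lemma ends_mkedge d i j : i != j -> ends (mkedge d i j) = [set i; j].
Proof.
move=> ij; rewrite /ends /fst_end /snd_end val_mkedge //.
by case: ifP => // _; rewrite setUC.
Qed.

Lemma in_ends x e : (x \in ends e) = (x == fst_end e) || (x == snd_end e).
Proof. by rewrite !inE. Qed.

Lemma card_ends e : #|ends e| = 2.
Proof.
rewrite /ends cards2; case: eqP => // eq_e.
by have := fst_lt_snd e; rewrite eq_e ltnn.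
Qed.

Lemma card_edge : #|{: edge n}| = 'C(n, 2).
Proof.
rewrite -[in RHS](card_ord n) -card_draws -(card_imset _ ends_inj).
apply: eq_card => A; rewrite inE; apply/imsetP/idP => [[e _ ->]|].
  by rewrite card_ends.
case/cards2P=> i [j [ij ->]].
pose p := if (i < j)%N then (i, j) else (j, i).
have lt_p : (p.1 < p.2)%N.
  by rewrite /p; case: (ltngtP i j) => //= eij; rewrite (val_inj eij) eqxx in ij.
pose d : edge n := exist _ p lt_p.
by exists (mkedge d i j); rewrite ?inE ?ends_mkedge.
Qed.

Lemma sum_over_matching (A : nmodType) U (E : {set edge n}) (F : 'I_n -> A) :
    perfect_matching U E ->
  \sum_(x in U) F x = \sum_(e in E) (F (fst_end e) + F (snd_end e)).
Proof.
move=> UE; rewrite (set_partition_big _ UE) /= big_imset /=; last first.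
  by move=> e f _ _; apply: ends_inj.
apply: eq_bigr => e _; rewrite /ends big_setU1 ?big_set1 // inE.
by apply/eqP=> eq_e; have := fst_lt_snd e; rewrite eq_e ltnn.
Qed.

Lemma matching_sub U E e : perfect_matching U E -> e \in E ->
  fst_end e \in U /\ snd_end e \in U.
Proof.
move=> UE eE; have /subsetP sub_e := partitionS UE (imset_f (@ends n) eE).
by split; apply: sub_e; rewrite !inE eqxx ?orbT.
Qed.

Lemma matching_cover U E x : perfect_matching U E -> x \in U ->
  exists2 e, e \in E & x = fst_end e \/ x = snd_end e.
Proof.
move=> UE; rewrite -(cover_partition UE) => /bigcupP[_ /imsetP[e eE ->]].
by rewrite in_ends => /orP[]/eqP; exists e => //; [left | right].
Qed.

Lemma card_over_matching U E (P : pred 'I_n) : perfect_matching U E ->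
  #|[set z in U | P z]| = (\sum_(e in E) (P (fst_end e) + P (snd_end e)))%N.
Proof.
move=> UE; rewrite -sum1_card.
rewrite (eq_bigl (fun z => (z \in U) && P z)) => [|z]; last by rewrite inE.
rewrite big_mkcondr (sum_over_matching (A := nat) _ UE) /=.
by apply: eq_bigr => e _; do 2!case: (P _).
Qed.

Lemma matching_card U E : perfect_matching U E -> #|U| = (2 * #|E|)%N.
Proof.
move=> UE; have := card_over_matching predT UE; rewrite (eq_bigr (fun=> 2)) //.
rewrite sum_nat_const mulnC => <-.
by apply: eq_card => z; rewrite inE andbT.
Qed.

Section Family.
Variables (m : nat) (x y : 'I_m -> 'I_n) (d : edge n).
Hypotheses (x_inj : injective x) (y_inj : injective y).
Hypothesis xy : forall s t, x s != y t.

Definition family_matching := [set mkedge d (x t) (y t) | t : 'I_m].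
Definition family_support := [set x t | t : 'I_m] :|: [set y t | t : 'I_m].

Lemma family_edge_inj : injective (fun t => mkedge d (x t) (y t)).
Proof.
move=> s t /= st; have := ends_mkedge d (xy s s); rewrite st ends_mkedge //.
move=> /setP/(_ (x s)); rewrite !inE eqxx (negPf (xy _ _)) orbF.
by move/eqP/x_inj.
Qed.

Lemma family_matching_card : #|family_matching| = m.
Proof. by rewrite card_imset ?card_ord //; apply: family_edge_inj. Qed.

Lemma family_matchingP : perfect_matching family_support family_matching.
Proof.
have [] := trivIimset (J := mem family_matching) (F := @ends n).
- move=> _ _ /imsetP[s _ ->] /imsetP[t _ ->] ts.
  rewrite !ends_mkedge //; apply/pred0P=> z /=; rewrite !inE.
  have st : s != t by apply: contra_neq ts => ->.
  apply/negP=> /andP[] /orP[] /eqP-> /orP[] /eqP e.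
  + by move: st; rewrite (x_inj e) eqxx.
  + by move: (xy s t); rewrite e eqxx.
  + by move: (xy t s); rewrite e eqxx.
  + by move: st; rewrite (y_inj e) eqxx.
- by apply/imsetP=> -[e _ e0]; have := card_ends e; rewrite -e0 cards0.
move=> tI _; apply/and3P; split=> //; last first.
  by apply/imsetP=> -[e _ e0]; have := card_ends e; rewrite -e0 cards0.
apply/eqP/setP=> z; apply/bigcupP/setUP.
  case=> _ /imsetP[_ /imsetP[t _ ->] ->]; rewrite ends_mkedge // !inE.
  by case/orP=> /eqP->; [left | right]; apply: imset_f.
have in_blocks t : ends (mkedge d (x t) (y t)) \in [set ends e | e in family_matching].
  by do 2![apply: imset_f].
by case=> /imsetP[t _ ->]; exists (ends (mkedge d (x t) (y t)));
  rewrite // ends_mkedge // !inE eqxx ?orbT.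
Qed.

Lemma family_support_card : #|family_support| = (2 * m)%N.
Proof. by rewrite (matching_card family_matchingP) family_matching_card. Qed.

End Family.

Lemma gap_val i j : gap i j = if (i <= j)%N then (j - i)%N else (j + n - i)%N.
Proof.
rewrite /gap; have ltj := ltn_ord j; have lti := ltn_ord i.
case: leqP => ij; last by rewrite modn_small //; lia.
by rewrite (_ : j + n - i = j - i + n)%N ?modnDr ?modn_small //; lia.
Qed.

Lemma card_le_size (A : {set 'I_n}) (s : seq nat) :
  {in A, forall z, val z \in s} -> (#|A| <= size s)%N.
Proof.
move=> As; rewrite cardE -(size_map val); apply: uniq_leq_size.
  by rewrite map_inj_uniq ?enum_uniq //; apply: val_inj.
by move=> _ /mapP[z zA ->]; apply: As; rewrite mem_enum in zA.
Qed.

Section Crossing.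
Variables (U : {set 'I_n}) (k : nat).

(** Each of the [k] other edges crosses [e], so it has exactly one endpoint strictly between the
    endpoints of [e]. *)
Lemma crossing_between E e : perfect_matching U E -> is_crossing k.+1 E ->
  e \in E -> #|[set z in U | (fst_end e < z < snd_end e)%N]| = k.
Proof.
move=> UE [cardE crossE] eE.
rewrite (card_over_matching _ UE) (bigD1 e) //= !ltnn andbF !add0n.
rewrite (eq_bigr (fun=> 1%N)) => [|f /andP[fE fe]].
  rewrite sum1_card; have := cardsD1 e E; rewrite cardE eE add1n => -[->].
  by apply: eq_card => f; rewrite !inE andbC.
have := crossE _ _ eE fE; rewrite eq_sym => /(_ fe).
have := fst_lt_snd f; have := fst_lt_snd e; rewrite /crosses.
lia.
Qed.

Hypothesis card_U : #|U| = (2 * k + 2)%N.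

(** Of the [2k+2] points, two are the ends of [e] and [k] lie between them, which leaves [k]
    outside. *)
Lemma crossing_outside E e : perfect_matching U E -> is_crossing k.+1 E ->
  e \in E -> #|[set z in U | (z < fst_end e)%N || (snd_end e < z)%N]| = k.
Proof.
move=> UE cE eE; have [e1U e2U] := matching_sub UE eE.
have lt_e := fst_lt_snd e.
have := crossing_between UE cE eE.
have := cardsID [set z in U | (fst_end e <= z <= snd_end e)%N] U.
rewrite card_U.
have -> : U :&: [set z in U | (fst_end e <= z <= snd_end e)%N] =
   fst_end e |: (snd_end e |: [set z in U | (fst_end e < z < snd_end e)%N]).
  apply/setP=> z; rewrite !inE -!val_eqE /=.
  have [zU|] := boolP (z \in U); first by rewrite !andTb; lia.
  move=> nzU; have -> : (z == fst_end e :> nat) = false.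
    by apply/negbTE; apply: contra nzU => /eqP/val_inj->.
  by apply/esym/negbTE; rewrite orFb orbF; apply: contra nzU => /eqP/val_inj->.
rewrite !cardsU1 !inE !ltnn !andbF /= -val_eqE /= (ltn_eqF lt_e) /= !add1n.
move=> eq_k be; rewrite be in eq_k.
have -> : [set z in U | (z < fst_end e)%N || (snd_end e < z)%N] =
          U :\: [set z in U | (fst_end e <= z <= snd_end e)%N].
  apply/setP=> z; rewrite !inE; case: (z \in U) => //=.
  by rewrite andbT; lia.
by apply/eqP; rewrite -(eqn_add2l k.+2) eq_k; apply/eqP; lia.
Qed.

(** The counts inside and outside an edge determine the partner of each point. Let [f] be the edge
    of [E'] at the first end of [e]; the two cases are that this point is the first or the second
    end of [f]. *)
Lemma crossing_sub E E' : perfect_matching U E -> is_crossing k.+1 E ->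
  perfect_matching U E' -> is_crossing k.+1 E' -> E \subset E'.
Proof.
move=> UE cE UE' cE'; apply/subsetP=> e eE.
have [e1U e2U] := matching_sub UE eE.
have be := crossing_between UE cE eE.
have oe := crossing_outside UE cE eE.
have [f fE' e1f] := matching_cover UE' e1U.
have [f1U f2U] := matching_sub UE' fE'.
have bf := crossing_between UE' cE' fE'.
have lt_e := fst_lt_snd e; have lt_f := fst_lt_snd f.
case: e1f => e1f.
  suff -> : e = f by [].
  apply: edge_eq => //; apply: val_inj.
  (* If two edges start at the same point and [h] reaches further, then the second end of [g] is an
     additional point inside [h], which would hold [k+1] points. *)
  have aux (g h : edge n) : fst_end g = fst_end h -> snd_end g \in U ->
      #|[set z in U | (fst_end g < z < snd_end g)%N]| = k ->
      #|[set z in U | (fst_end h < z < snd_end h)%N]| = k ->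
      ~~ (snd_end g < snd_end h)%N.
    move=> gh gU bg bh; apply/negP=> lt_gh.
    suff : (k.+1 <= k)%N by rewrite ltnn.
    rewrite -{1}bg -bh.
    set A := [set z in U | (fst_end g < z < snd_end g)%N].
    have -> : #|A|.+1 = #|snd_end g |: A|.
      by rewrite cardsU1 !inE ltnn !andbF.
    apply/subset_leq_card/subsetP=> z; rewrite !inE -gh.
    case/orP=> [/eqP->|/and3P[-> -> /ltn_trans->//]].
    by rewrite gU lt_gh fst_lt_snd.
  by apply/anti_leq/andP; split; rewrite leqNgt; apply: aux.
(* Here [f] ends where [e] starts, so the first end of [f] and the [k] points inside [f] would be
   [k+1] points outside [e]. *)
exfalso; suff : (k.+1 <= k)%N by rewrite ltnn.
rewrite -{1}bf -oe.
set A := [set z in U | (fst_end f < z < snd_end f)%N].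
have -> : #|A|.+1 = #|fst_end f |: A| by rewrite cardsU1 !inE ltnn !andbF.
apply/subset_leq_card/subsetP=> z; rewrite !inE e1f.
case/orP=> [/eqP->|/and3P[-> _ ->//]].
by rewrite f1U lt_f.
Qed.

Lemma crossing_unique E E' : perfect_matching U E -> is_crossing k.+1 E ->
  perfect_matching U E' -> is_crossing k.+1 E' -> E = E'.
Proof. by move=> *; apply/eqP; rewrite eqEsubset !crossing_sub. Qed.

(** Both arcs between the ends of [e] contain [k] points of [U] in their interior, so both have
    length at least [k+1]. *)
Lemma crossing_edist E e : perfect_matching U E -> is_crossing k.+1 E ->
  e \in E -> (k < edist e)%N.
Proof.
move=> UE cE eE; have lt_e := fst_lt_snd e; have lt_n := ltn_ord (snd_end e).
have b_le : (k <= snd_end e - (fst_end e).+1)%N.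
  rewrite -{1}(crossing_between UE cE eE).
  rewrite -(size_iota (fst_end e).+1 (snd_end e - (fst_end e).+1)).
  by apply: card_le_size => z; rewrite inE mem_iota => /and3P[_] /=; lia.
have o_le : (k <= fst_end e + (n - (snd_end e).+1))%N.
  rewrite -{1}(crossing_outside UE cE eE).
  rewrite [leqRHS](_ : _ = size (iota 0 (fst_end e)
    ++ iota (snd_end e).+1 (n - (snd_end e).+1))); last first.
    by rewrite size_cat !size_iota.
  apply: card_le_size => z; rewrite inE mem_cat !mem_iota => /andP[_].
  by have := ltn_ord z; rewrite /=; lia.
rewrite /edist /cdist !gap_val (ltnW lt_e) [(snd_end e <= _)%N]leqNgt lt_e /=; lia.
Qed.

End Crossing.
End Edges.

(** * Cyclic shifts, and crossings built from points in cyclic order *)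

Section Shift.
Variable n : nat.
Implicit Types (a b i j : 'I_n) (e f : edge n).

(** The point [a + x] modulo [n]. Iterating [ordS] makes [shift a x.+1] convertible to
    [ordS (shift a x)]. *)
Definition shift a (x : nat) : 'I_n := iter x (@ordS n) a.

Lemma shiftS a x : shift a x.+1 = ordS (shift a x).
Proof. by []. Qed.

Lemma val_shift_mod a x : shift a x = ((a + x) %% n)%N :> nat.
Proof.
elim: x => [|x IHx] /=; first by rewrite addn0 modn_small.
by rewrite /shift /= -/(shift a x) IHx -addn1 modnDml addn1 addnS.
Qed.

(** Splitting on wrap-around turns modular goals into linear arithmetic; [ordS_val] and [gap_cases]
    serve the same purpose. *)
Lemma val_shift a x : (x < n)%N ->
  (a + x < n)%N /\ shift a x = (a + x)%N :> nat
  \/ (n <= a + x)%N /\ shift a x = (a + x - n)%N :> nat.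
Proof.
move=> lt_x; rewrite val_shift_mod; have lt_a := ltn_ord a.
case: (ltnP (a + x) n) => axn; [left | right]; split=> //.
  by rewrite modn_small.
by rewrite -{1}(subnK axn) modnDr modn_small //; lia.
Qed.

Lemma ordS_val i : (i.+1 < n)%N /\ ordS i = i.+1 :> nat
  \/ i.+1 = n /\ ordS i = 0%N :> nat.
Proof.
have lt_i := ltn_ord i; case: (ltnP i.+1 n) => in_; [left | right]; split=> //=.
- by rewrite modn_small.
- lia.
by have -> : i.+1 = n by [lia]; rewrite modnn.
Qed.

Lemma shift_inj a x y : (x < n)%N -> (y < n)%N -> shift a x = shift a y -> x = y.
Proof.
move=> xn yn /(congr1 val) /=.
by case: (val_shift a xn) => -[? ->]; case: (val_shift a yn) => -[? ->]; lia.
Qed.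

Lemma gap_cases i j : (i <= j)%N /\ gap i j = (j - i)%N
  \/ (j < i)%N /\ gap i j = (j + n - i)%N.
Proof. by rewrite gap_val; case: leqP; [left | right]. Qed.

Lemma gap_ltn i j : (gap i j < n)%N.
Proof. by rewrite ltn_pmod // (leq_ltn_trans _ (ltn_ord i)). Qed.

Lemma gap_shift a x y : (x <= y)%N -> (y < n)%N ->
  gap (shift a x) (shift a y) = (y - x)%N.
Proof.
move=> xy yn; have xn := leq_ltn_trans xy yn.
have := ltn_ord a.
by case: (val_shift a xn) => -[? xE]; case: (val_shift a yn) => -[? yE];
  case: (gap_cases (shift a x) (shift a y)) => -[]; rewrite xE yE; lia.
Qed.

Lemma gap_sym i j : i != j -> (gap i j + gap j i = n)%N.
Proof.
rewrite -val_eqE /= => ij; have := ltn_ord i; have := ltn_ord j.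
by case: (gap_cases i j) => -[? ->]; case: (gap_cases j i) => -[? ->]; lia.
Qed.

Lemma gap0 i : gap i i = 0%N.
Proof. by rewrite gap_val leqnn subnn. Qed.

Lemma shift_gap a b : shift a (gap a b) = b.
Proof.
apply: val_inj => /=; have := ltn_ord a; have := ltn_ord b.
by case: (val_shift a (gap_ltn a b)) => -[+ ->];
  case: (gap_cases a b) => -[? ->]; lia.
Qed.

Lemma shift_add a x y : shift (shift a x) y = shift a (x + y).
Proof. by rewrite /shift -iterD addnC. Qed.

Lemma cdistC i j : cdist i j = cdist j i.
Proof. by rewrite /cdist minnC. Qed.

Lemma cdist_shift a x y : (x < y)%N -> (y < n)%N ->
  cdist (shift a x) (shift a y) = minn (y - x) (n - (y - x)).
Proof.
move=> xy yn; rewrite /cdist.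
have neq : shift a x != shift a y.
  by apply/eqP=> /shift_inj; lia.
by have := gap_sym neq; rewrite gap_shift ?(ltnW xy) //; lia.
Qed.

Lemma edist_ends e i j : ends e = [set i; j] -> edist e = cdist i j.
Proof. by case/set2_ends=> -[-> ->] //; rewrite cdistC. Qed.

Lemma mkedge_ends d e i j : ends e = [set i; j] -> mkedge d i j = e.
Proof.
move=> eij; apply: ends_inj; rewrite ends_mkedge ?eij //.
by case/set2_ends: eij => -[-> ->]; rewrite -val_eqE /=;
  have := fst_lt_snd e; lia.
Qed.

(** Crossing depends only on the cyclic order; the four disjuncts are the rotations of the order x,
    z, y, w. *)
Lemma crosses_mkedge d (x y z w : 'I_n) :
    [|| [&& x < z, z < y & y < w], [&& z < y, y < w & w < x],
        [&& y < w, w < x & x < z] | [&& w < x, x < z & z < y]]%N ->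
  crosses (mkedge d x y) (mkedge d z w).
Proof.
move=> cyc; have xy : x != y by rewrite -val_eqE /=; lia.
have zw : z != w by rewrite -val_eqE /=; lia.
rewrite /crosses /fst_end /snd_end !val_mkedge //.
by case: (ltnP x y); case: (ltnP z w) => /=; lia.
Qed.

Lemma crossesC e f : crosses e f = crosses f e.
Proof. by rewrite /crosses orbC. Qed.

Section CyclicFamily.
Variables (m : nat) (a : 'I_n) (p q : 'I_m -> nat) (d : edge n).
Hypotheses (p_lt : forall s t : 'I_m, (s < t)%N -> (p s < p t)%N).
Hypotheses (q_lt : forall s t : 'I_m, (s < t)%N -> (q s < q t)%N).
Hypotheses (pq : forall s t, (p s < q t)%N) (qn : forall t, (q t < n)%N).
Let x t := shift a (p t).
Let y t := shift a (q t).

Lemma cyclic_family_inj :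
  [/\ injective x, injective y & forall s t, x s != y t].
Proof.
have pn t : (p t < n)%N by apply: ltn_trans (qn t).
split=> [s t /shift_inj|s t /shift_inj|s t].
- move=> /(_ (pn _) (pn _)) pst; apply: val_inj => /=.
  by case: (ltngtP s t) => // /p_lt; rewrite pst ltnn.
- move=> /(_ (qn _) (qn _)) pst; apply: val_inj => /=.
  by case: (ltngtP s t) => // /q_lt; rewrite pst ltnn.
by apply/eqP=> /shift_inj; have := pq s t; have := pn s; have := qn t; lia.
Qed.

(** From [a] onwards all points [x] come before all points [y], each family in increasing order; for
    [s < t] the cyclic order is thus [x s], [x t], [y s], [y t], and the two edges cross. *)
Lemma cyclic_family_crossing : is_crossing m (family_matching x y d).
Proof.
have [x_inj y_inj xy] := cyclic_family_inj.
split=> [|_ _ /imsetP[s _ ->] /imsetP[t _ ->] st]; first exact: family_matching_card.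
have {}st : s != t by apply: contra_neq st => ->.
wlog lt_st : s t st / (s < t)%N.
  move=> wl; have := st; rewrite -val_eqE neq_ltn /= => /orP[ts|ts].
    by apply: wl.
  by rewrite crossesC; apply: wl; rewrite // eq_sym.
apply: crosses_mkedge; have pn r : (p r < n)%N by apply: ltn_trans (qn r).
have := p_lt lt_st; have := q_lt lt_st; have := pq t s; have := ltn_ord a.
have := qn t; rewrite /x /y.
case: (val_shift a (pn s)) => -[? ->]; case: (val_shift a (pn t)) => -[? ->];
case: (val_shift a (qn s)) => -[? ->]; case: (val_shift a (qn t)) => -[? ->]; lia.
Qed.

End CyclicFamily.

(** With the points of [U] in increasing order, the crossing pairs the [t]-th with the
    [(t+k+1)]-st. *)
Lemma crossing_exists (U : {set 'I_n}) k : #|U| = (2 * k + 2)%N ->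
  exists2 X, perfect_matching U X & is_crossing k.+1 X.
Proof.
move=> cU; have a : 'I_n.
  by case: (set_0Vmem U) => [U0|[]//]; move: cU; rewrite U0 cards0; lia.
have d : edge n.
  have n_gt1 : (1 < n)%N.
    by have := max_card (mem U); rewrite card_ord cU; lia.
  exact: default_edge n_gt1.
have n_gt0 : (0 < n)%N := leq_ltn_trans (leq0n a) (ltn_ord a).
(* Based at the point 0, a shift by [c t] is the [t]-th point of [U] itself, so cyclic families
   apply to [U]. *)
pose z0 : 'I_n := Ordinal n_gt0.
pose c t : nat := nth z0 (enum U) t.
have szU : size (enum U) = (2 * k + 2)%N by rewrite -cardE.
have c_lt s t : (s < t)%N -> (t < 2 * k + 2)%N -> (c s < c t)%N.
  move=> st tk; rewrite /c.
  have so : sorted (relpre val ltn) (enum U).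
    rewrite /enum_mem -enumT; apply: sorted_filter => [x y z|].
      exact: ltn_trans.
    by rewrite -sorted_map val_enum_ord iota_ltn_sorted.
  apply: (sorted_ltn_nth _ z0 so) => //; last 2 first.
  - by rewrite inE szU (ltn_trans st).
  - by rewrite inE szU.
  by move=> x y z; apply: ltn_trans.
have cn t : (c t < n)%N by exact: ltn_ord.
have zc t : shift z0 (c t) = nth z0 (enum U) t.
  apply: val_inj; rewrite /= -/(c t); have := cn t.
  by case: (val_shift z0 (cn t)) => -[] /= + ->; lia.
pose p (t : 'I_k.+1) := c t; pose q (t : 'I_k.+1) := c (t + k.+1)%N.
have pq1 (s t : 'I_k.+1) : (s < t)%N -> (p s < p t)%N.
  by move=> st; apply: c_lt => //; have := ltn_ord t; lia.
have pq2 (s t : 'I_k.+1) : (s < t)%N -> (q s < q t)%N.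
  by move=> st; apply: c_lt => //; have := ltn_ord t; lia.
have pq3 (s t : 'I_k.+1) : (p s < q t)%N.
  by apply: c_lt => //; have := ltn_ord t; have := ltn_ord s; lia.
have pq4 t : (q t < n)%N by exact: cn.
have [x_inj y_inj xy] := cyclic_family_inj z0 pq1 pq2 pq3 pq4.
exists (family_matching (fun t => shift z0 (p t)) (fun t => shift z0 (q t)) d);
  last exact: cyclic_family_crossing.
have := family_matchingP d x_inj y_inj xy.
set S := family_support _ _; suff -> : S = U by [].
apply/eqP; rewrite eqEcard (family_support_card d) // cU leq_eqVlt.
have -> /= : (2 * k + 2 == 2 * k.+1)%N by lia.
rewrite andbT; apply/subsetP=> z; rewrite inE.
by case/orP=> /imsetP[t _ ->]; rewrite zc -mem_enum mem_nth // szU;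
  have := ltn_ord t; lia.
Qed.

End Shift.

(** * The inequalities *)

Section Forms.
Variables (R : realFieldType) (n : nat).
Local Notation vec := {ffun edge n -> R^o}.
Implicit Types (u v w : vec) (a b i j : 'I_n) (e f : edge n) (E : {set edge n}).

Lemma entry_sym v i j : entry v i j = entry v j i.
Proof.
by rewrite /entry; case: (ltngtP i j) => // /val_inj->.
Qed.

Lemma entry_ends v e i j : ends e = [set i; j] -> entry v i j = v e.
Proof.
suff fse : entry v (fst_end e) (snd_end e) = v e.
  by case/set2_ends=> -[-> ->] //; rewrite entry_sym.
rewrite /entry fst_lt_snd -surjective_pairing.
by rewrite valK.
Qed.

Lemma entry_diag v i : entry v i i = 0.
Proof. by rewrite /entry ltnn insubF //= ltnn. Qed.

(** A symmetric formula needs checking only on ordered pairs, provided that it matches the dummy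
    value 0 of [entry] on the diagonal. *)
Lemma entry_cases v (F : 'I_n -> 'I_n -> R) :
    (forall i j, F i j = F j i) -> (forall i, F i i = 0) ->
    (forall e, v e = F (fst_end e) (snd_end e)) ->
  forall i j, entry v i j = F i j.
Proof.
move=> symF diagF vF i j; have [->|ij] := eqVneq i j.
  by rewrite entry_diag diagF.
have d : edge n.
  have n_gt1 : (1 < n)%N.
    by move: ij; rewrite -val_eqE /=; have := ltn_ord i; have := ltn_ord j; lia.
  exact: default_edge n_gt1.
have eE := ends_mkedge d ij; rewrite (entry_ends _ eE) vF.
by case: (set2_ends eE) => -[<- <-].
Qed.

Lemma entry_linear (a : R) u v i j :
  entry (a *: u + v) i j = a * entry u i j + entry v i j.
Proof.
rewrite /entry; case: insub => [e|] /=; last by rewrite mulr0 addr0.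
by rewrite !ffunE.
Qed.

Lemma s_form_linear i j : linear (s_form i j : vec -> R^o).
Proof.
move=> a u v; rewrite /s_form !entry_linear /GRing.scale /=; ring.
Qed.

Lemma s_edge_linear e : linear (s_edge e : vec -> R^o).
Proof. exact: s_form_linear. Qed.

Lemma short_form_linear k e : linear (short_form k e : vec -> R^o).
Proof.
move=> a u v; rewrite /short_form scaler_sumr -big_split /=.
by apply: eq_bigr => f _; apply: s_edge_linear.
Qed.

Lemma s_form_sym v i j : s_form i j v = s_form j i v.
Proof.
rewrite /s_form (entry_sym v i j) (entry_sym v (ordS i)) (entry_sym v i).
by rewrite (entry_sym v (ordS i)); ring.
Qed.

Lemma s_edge_ends v e i j : ends e = [set i; j] -> s_edge e v = s_form i j v.
Proof. by case/set2_ends=> -[-> ->] //; rewrite s_form_sym. Qed.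

Lemma weight_family m (x y : 'I_m -> 'I_n) d v :
    injective x -> (forall s t, x s != y t) ->
  weight v (family_matching x y d) = \sum_t entry v (x t) (y t).
Proof.
move=> x_inj xy; rewrite /weight /family_matching big_imset /=; last first.
  by move=> s t _ _; apply: family_edge_inj.
by apply: eq_bigr => t _; apply/esym/entry_ends/ends_mkedge.
Qed.

(* The excess of the matching {a+t, a+g+t} (t <= m) over the one replacing
   these edges by {a+t, a+g+t+1} (t < m) and {a+m, a+g}. *)
Definition cyc_form a (g m : nat) v : R :=
  \sum_(t < m.+1) entry v (shift a t) (shift a (g + t))
  - \sum_(t < m) entry v (shift a t) (shift a (g + t.+1))
  - entry v (shift a m) (shift a g).

(** The cycle 0 -> 1 -> ... -> m -> 0, extended by the identity above [m]; it rotates the partners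
    of the first [m+1] edges. *)
Definition rotate_below m t : nat :=
  if (t < m)%N then t.+1 else if t == m then 0 else t.

(** Edges with index above [m] are added to both matchings and cancel. Both sums then run over [k+1]
    edges on the same [2k+2] points. *)
Lemma cyc_formE a (g m k : nat) v : (m <= k)%N ->
  cyc_form a g m v = \sum_(t < k.+1) entry v (shift a t) (shift a (g + t))
    - \sum_(t < k.+1) entry v (shift a t) (shift a (g + rotate_below m t)).
Proof.
move=> mk; rewrite -sumrB.
pose G t := entry v (shift a t) (shift a (g + t))
  - entry v (shift a t) (shift a (g + rotate_below m t)).
rewrite -(big_mkord xpredT G) (big_cat_nat (n := m.+1)) //=.
rewrite [X in _ + X]big1_seq ?addr0 => [|t]; last first.
  rewrite mem_index_iota /G /rotate_below => /andP[_ /andP[mt _]].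
  by rewrite ltnNge (ltnW mt) /= gtn_eqF // subrr.
rewrite big_mkord big_ord_recr /= /cyc_form big_ord_recr /= {2}/G /rotate_below.
rewrite ltnn eqxx addn0.
have -> : \sum_(t < m) G t = \sum_(t < m) (entry v (shift a t) (shift a (g + t))
    - entry v (shift a t) (shift a (g + t.+1))).
  by apply: eq_bigr => t _; rewrite /G /rotate_below ltn_ord.
by rewrite sumrB; ring.
Qed.

(** The bounds on [g] put the points [a+t] and [a+g+t], [t <= k], in cyclic order without
    repetition. The first sum of [cyc_formE] is then the weight of their crossing and the second
    that of a rival matching. *)
Lemma Grob_cyc_form_ge0 (k g m : nat) a v :
    Grob k v -> (k < g)%N -> (g + k < n)%N -> (m <= k)%N ->
  0 <= cyc_form a g m v.
Proof.
move=> Gv kg gkn mk; rewrite (cyc_formE _ _ _ mk) subr_ge0.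
have d : edge n.
  have n_gt1 : (1 < n)%N by lia.
  exact: default_edge n_gt1.
pose p (t : 'I_k.+1) : nat := t; pose q (t : 'I_k.+1) := (g + t)%N.
have p_lt (s t : 'I_k.+1) : (s < t)%N -> (p s < p t)%N by [].
have q_lt (s t : 'I_k.+1) : (s < t)%N -> (q s < q t)%N by rewrite ltn_add2l.
have pq (s t : 'I_k.+1) : (p s < q t)%N by rewrite /p /q; have := ltn_ord s; lia.
have qn t : (q t < n)%N by rewrite /q; have := ltn_ord t; lia.
pose x t := shift a (p t); pose y t := shift a (q t).
have [x_inj y_inj xy] := cyclic_family_inj a p_lt q_lt pq qn.
have cX := cyclic_family_crossing a d p_lt q_lt pq qn.
have UX := family_matchingP d x_inj y_inj xy.
have rP (t : 'I_k.+1) : (rotate_below m t < k.+1)%N.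
  rewrite /rotate_below; have := ltn_ord t.
  by case: (ltnP t m) => ?; [lia | case: eqP].
pose r t := Ordinal (rP t).
have r_inj : injective r.
  move=> s t /(congr1 val) /=; rewrite /rotate_below => st; apply: val_inj.
  move: st => /=.
  by case: (ltnP s m); case: (ltnP t m); case: (eqVneq (s : nat) m);
    case: (eqVneq (t : nat) m); lia.
have yr_inj : injective (y \o r) by exact: inj_comp.
have xyr s t : x s != (y \o r) t by exact: xy.
have Ur := family_matchingP d x_inj yr_inj xyr.
(* Rotating the partners permutes the points [y t], so the rival matching covers the same set. *)
have suppE : family_support x (y \o r) = family_support x y.
  rewrite /family_support; congr (_ :|: _).
  have [r' rK r'K] := injF_bij r_inj.
  apply/setP=> z; apply/imsetP/imsetP=> -[t _ ->]; first by exists (r t).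
  by exists (r' t); rewrite //= r'K.
rewrite suppE in Ur.
have cU : #|family_support x y| = (2 * k + 2)%N.
  by rewrite (family_support_card d) //; lia.
(* Membership in the cone supplies some maximal crossing; uniqueness identifies it with the explicit
   one. *)
have [X [UX' cX' Xmax]] := Gv _ cU.
have := Xmax _ Ur; rewrite (crossing_unique cU UX' cX' UX cX).
by rewrite !weight_family.
Qed.

Lemma s_form_cyc a g v : s_form a (shift a g) v = cyc_form a g 1 v.
Proof.
rewrite /cyc_form /s_form !big_ord_recl !big_ord0 /= !addr0 addn0 addn1.
by rewrite -!shiftS /=; ring.
Qed.

(** Written as a mixed second difference, [s_form] telescopes along rows. *)
Lemma s_form_diff a p q v :
  s_form (shift a p) (shift a q) v =
  (entry v (shift a p) (shift a q) - entry v (shift a p) (shift a q.+1))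
  - (entry v (shift a p.+1) (shift a q) - entry v (shift a p.+1) (shift a q.+1)).
Proof. by rewrite /s_form -!shiftS; ring. Qed.

Lemma cyc_form_triangle a g m v :
  cyc_form a g m v =
  \sum_(p < m) \sum_(q < p.+1) s_form (shift a p) (shift a (g + q)) v.
Proof.
elim: m => [|m IHm].
  by rewrite /cyc_form big_ord_recl !big_ord0 addn0 /= addr0 subr0 subrr.
(* Passing from [m] to [m+1] adds the row [p = m], whose terms are [D q.+1 - D q]; its sum
   [D m.+1 - D 0] consists of the four entries by which the two cyclic forms differ. *)
pose D q : R := entry v (shift a m.+1) (shift a (g + q))
  - entry v (shift a m) (shift a (g + q)).
have rowE : \sum_(q < m.+1) s_form (shift a m) (shift a (g + q)) v
    = D m.+1 - D 0.
  rewrite -telescope_sumr // big_mkord; apply: eq_bigr => q _.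
  by rewrite s_form_diff /D addnS; ring.
rewrite big_ord_recr -IHm /= rowE /cyc_form /D addn0.
rewrite (big_ord_recr m.+1) /= (big_ord_recr m) /=.
rewrite [X in _ - X - _ = _](big_ord_recr m) /=.
ring.
Qed.

End Forms.

(** * Short sides of edges, and the short inequalities as sums over triangles *)

Section ShortSides.
Variable n : nat.
Implicit Types (a b i j : 'I_n) (e f : edge n).

Lemma shift_base_inj x : injective (fun a => shift a x).
Proof.
move=> a b /(congr1 val) /=; rewrite !val_shift_mod => /eqP.
by rewrite eqn_modDr !modn_small // => /eqP/val_inj.
Qed.

Lemma short_orientation e :
  exists i j, [/\ ends e = [set i; j], gap i j = edist e
                & short_side e = cyc_interval i j].
Proof.
rewrite /short_side; case: eqP => [<-|ne].
  by exists (fst_end e), (snd_end e).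
exists (snd_end e), (fst_end e); split=> //; first by rewrite /ends setUC.
by move: ne; rewrite /edist /cdist; lia.
Qed.

Lemma ends_neq e i j : ends e = [set i; j] -> i != j.
Proof.
by have := fst_lt_snd e => lt_e /set2_ends[] [-> ->]; rewrite -val_eqE /=; lia.
Qed.

Lemma edist_gap e i j : ends e = [set i; j] -> (2 * gap i j < n)%N ->
  edist e = gap i j.
Proof.
by move=> eij sh; rewrite (edist_ends eij) /cdist;
  have := gap_sym (ends_neq eij); lia.
Qed.

Lemma short_side_ends e i j : ends e = [set i; j] -> (2 * gap i j < n)%N ->
  short_side e = cyc_interval i j.
Proof.
move=> eij sh; have dE := edist_gap eij sh.
have sym := gap_sym (ends_neq eij).
rewrite /short_side dE; case: (set2_ends eij) dE sh sym => -[-> ->] dE sh sym.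
  by rewrite eqxx.
by rewrite ifN //; lia.
Qed.

(** The two gaps between the ends of an edge add up to [n], so at most one of them is below
    [n/2]. *)
Lemma short_orientation_unique e i j i' j' :
    ends e = [set i; j] -> ends e = [set i'; j'] ->
    (2 * gap i j < n)%N -> (2 * gap i' j' < n)%N ->
  i = i' /\ j = j'.
Proof.
move=> eij eij' sh sh'; have := gap_sym (ends_neq eij).
by case: (set2_ends eij) (set2_ends eij') sh sh' => -[-> ->] [] [-> ->] //; lia.
Qed.

(* For 2 <= edist e <= k+1 the generator dual to the inequality of [e] is
   - basis_vec (inner e). *)
Definition inner e : edge n :=
  if gap (fst_end e) (snd_end e) == edist e
  then mkedge e (ordS (fst_end e)) (snd_end e)
  else mkedge e (ordS (snd_end e)) (fst_end e).

Lemma inner_ends e i j : ends e = [set i; j] ->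
  (1 < gap i j)%N -> (2 * gap i j < n)%N -> ends (inner e) = [set ordS i; j].
Proof.
move=> eij g1 sh; have dE := edist_gap eij sh.
have sym := gap_sym (ends_neq eij).
have ne : ordS i != j.
  apply/eqP=> ij; have := gap_shift i (leq0n 1); rewrite /= ij; lia.
rewrite /inner dE; case: (set2_ends eij) dE sh sym ne => -[-> ->] dE sh sym ne.
  by rewrite eqxx ends_mkedge.
by rewrite ifN ?ends_mkedge //; lia.
Qed.

(* With these [a] and [m], [cyc_form a k.+1 m] is the inequality of [e]. *)
Lemma anchored_edge k e : (2 * k + 3 <= n)%N -> (1 < edist e <= k + 1)%N ->
  exists a m, [/\ (0 < m <= k)%N, (edist e + m = k + 2)%N
    & ends e = [set shift a m.-1; shift a k.+1]].
Proof.
move=> hn e_low; have [i [j [eij gE _]]] := short_orientation e.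
(* [a] is [i - (m-1)] modulo [n]; then [a + k + 1] is [i + (k+2-m)], that is [i + edist e], which is
   [j]. *)
pose m := (k + 2 - edist e)%N; pose a := shift i (n - m.-1).
have aE : shift a m.-1 = i.
  rewrite /a shift_add subnK; last by lia.
  by apply: val_inj; rewrite /= val_shift_mod modnDr modn_small.
exists a, m; split; [lia | lia | rewrite eij aE; congr [set _; _]].
by rewrite -{1}(shift_gap i j) gE -{1}aE shift_add; congr shift; lia.
Qed.

Section Triangle.
Variables (R : realFieldType) (k m : nat) (a : 'I_n) (e : edge n).
Hypotheses (hn : (2 * k + 3 <= n)%N) (hm : (0 < m <= k)%N).
Hypothesis ends_e : ends e = [set shift a m.-1; shift a k.+1].

Let h (t : 'I_m * 'I_m) := mkedge e (shift a t.1) (shift a (k.+1 + t.2)).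

Lemma triangle_gap p q : (p < m)%N -> (q <= p)%N ->
  gap (shift a p) (shift a (k.+1 + q)) = (k.+1 + q - p)%N.
Proof. by move=> pm qp; rewrite gap_shift; lia. Qed.

Lemma triangle_ends (t : 'I_m * 'I_m) : (t.2 <= t.1)%N ->
  ends (h t) = [set shift a t.1; shift a (k.+1 + t.2)].
Proof.
move=> qp; rewrite ends_mkedge //; apply/eqP=> /shift_inj.
have := ltn_ord t.1; lia.
Qed.

Lemma triangle_inj : {in [set t : 'I_m * 'I_m | (t.2 <= t.1)%N] &, injective h}.
Proof.
move=> [p q] [p' q']; rewrite !inE /= => tA t'A /(congr1 (@ends n)).
rewrite !triangle_ends //= => eqs.
have := ltn_ord p; have := ltn_ord p' => lt1 lt2.
have : shift a p \in [set shift a p'; shift a (k.+1 + q')].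
  by rewrite -eqs set21.
have : shift a (k.+1 + q) \in [set shift a p'; shift a (k.+1 + q')].
  by rewrite -eqs set22.
rewrite !inE; case/orP=> /eqP/shift_inj q_eq /orP[] /eqP/shift_inj p_eq;
  have {}q_eq := q_eq ltac:(lia) ltac:(lia);
  have {}p_eq := p_eq ltac:(lia) ltac:(lia); try lia.
by congr pair; apply: val_inj => /=; lia.
Qed.

(** An arc around the short side of [e] runs from [a+p] to [a+k+1+q] with [p < m] and [q >= 0]; its
    length [k+1+q-p] is at most [k+1] exactly when [q <= p]. *)
Lemma triangle_image : h @: [set t : 'I_m * 'I_m | (t.2 <= t.1)%N] =
  [set f | (edist f <= k + 1)%N && (ends e \subset short_side f)].
Proof.
apply/setP=> f; rewrite inE; apply/imsetP/andP=> [[[p q]]|[d_le sub]].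
  rewrite inE /= => tA ->; have lt1 := ltn_ord p.
  have gE := triangle_gap lt1 tA.
  have hE : ends (h (p, q)) = [set shift a p; shift a (k.+1 + q)].
    exact: triangle_ends.
  have sh : (2 * gap (shift a p) (shift a (k.+1 + q)) < n)%N by rewrite gE; lia.
  rewrite (edist_gap hE sh) (short_side_ends hE sh) ends_e.
  split; first by rewrite gE; lia.
  apply/subsetP=> z; rewrite !inE gE.
  by case/orP=> /eqP->; rewrite gap_shift; lia.
have [i [j [fij gE ssE]]] := short_orientation f.
move: sub; rewrite ends_e ssE => /subsetP sub.
have := sub _ (set21 _ _); have := sub _ (set22 _ _); rewrite !inE gE.
(* [u] is the distance by which the short side of [f] starts before [a+m-1]. The length bound forces
   [u < m], so [p = m-1-u], and [q] is the excess of the far end over [a+k+1]. *)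
set u := gap i (shift a m.-1).
have uE : shift i u = shift a m.-1 by exact: shift_gap.
have wE : shift a k.+1 = shift i (u + (k.+2 - m)).
  by rewrite -shift_add uE shift_add; congr shift; lia.
move=> w_le u_le; have un : (u + (k.+2 - m) < n)%N by lia.
have {}w_le : (u + (k.+2 - m) <= edist f)%N.
  by move: w_le; rewrite wE -{1}[i]/(shift i 0) gap_shift // subn0.
have iE : i = shift a (m.-1 - u).
  apply: (@shift_base_inj u); rewrite /= uE shift_add; congr shift; lia.
have jE : j = shift a (k.+1 + (edist f + (m.-1 - u) - k.+1)).
  by rewrite -(shift_gap i j) gE iE shift_add; congr shift; lia.
have pm : (m.-1 - u < m)%N by lia.
have qm : (edist f + (m.-1 - u) - k.+1 < m)%N by lia.
exists (Ordinal pm, Ordinal qm); first by rewrite inE /=; lia.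
apply: etrans (esym (mkedge_ends e fij)) _; rewrite /h /=.
by congr mkedge.
Qed.

Lemma short_form_cyc (v : {ffun edge n -> R^o}) :
  short_form k e v = cyc_form a k.+1 m v.
Proof.
rewrite /short_form cyc_form_triangle.
rewrite (eq_bigl (fun f => f \in h @: [set t : 'I_m * 'I_m | (t.2 <= t.1)%N]));
  last by move=> f; rewrite triangle_image inE.
rewrite big_imset /=; last exact: triangle_inj.
transitivity (\sum_(p < m) \sum_(q < m | (q < p.+1)%N)
    s_form (shift a p) (shift a (k.+1 + q)) v).
  rewrite pair_big_dep /=; apply: eq_big => [t|t]; rewrite inE ?ltnS //.
  by move=> tA; apply: s_edge_ends; apply: triangle_ends.
apply: eq_bigr => p _.
by rewrite (big_ord_widen m (fun q => s_form (shift a p) (shift a (k.+1 + q)) v)).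
Qed.

End Triangle.
End ShortSides.

(** * The generators *)

Section Generators.
Variables (R : realFieldType) (n : nat).
Local Notation vec := {ffun edge n -> R^o}.
Implicit Types (u v w : vec) (a b i j : 'I_n) (e f h : edge n) (E : {set edge n}).

(** Since the first end is smaller than the second, the cyclic interval does not wrap around. *)
Lemma in_arc h i :
  (i \in cyc_interval (ordS (fst_end h)) (snd_end h))
  = (fst_end h < i <= snd_end h)%N.
Proof.
rewrite inE; have lt_h := fst_lt_snd h; have := ltn_ord (snd_end h).
have := ltn_ord i.
case: (ordS_val (fst_end h)) => -[sv sE] ?; last by lia.
by case: (gap_cases (ordS (fst_end h)) i) => -[? ->];
  case: (gap_cases (ordS (fst_end h)) (snd_end h)) => -[? ->]; lia.
Qed.

Lemma entry_W h i j : entry (W_vec R h) i j =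
  ((fst_end h < i <= snd_end h)%N != (fst_end h < j <= snd_end h)%N)%:R.
Proof.
apply: (entry_cases (F := fun i j : 'I_n =>
  ((fst_end h < i <= snd_end h)%N != (fst_end h < j <= snd_end h)%N)%:R)).
- by move=> a b; rewrite eq_sym.
- by move=> a; rewrite eqxx.
by move=> e; rewrite ffunE !in_arc.
Qed.

Lemma entry_basis h i j : entry (basis_vec R h) i j = ([set i; j] == ends h)%:R.
Proof.
apply: (entry_cases (F := fun i j : 'I_n => ([set i; j] == ends h)%:R)).
- by move=> a b; rewrite setUC.
- move=> a; apply/eqP; rewrite pnatr_eq0 eqb0; apply/eqP=> ah.
  by have := card_ends h; rewrite -ah setUid cards1.
by move=> e; rewrite ffunE (inj_eq (@ends_inj n)).
Qed.

Lemma entry_star l i j : entry (star_vec R l) i j =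
  if i == j then 0 else (i == l)%:R + (j == l)%:R.
Proof.
apply: (entry_cases (F := fun i j : 'I_n =>
  if i == j then 0 else (i == l)%:R + (j == l)%:R)).
- by move=> a b; rewrite eq_sym addrC.
- by move=> a; rewrite eqxx.
move=> e; rewrite ffunE in_ends; have := fst_lt_snd e => lt_e.
have -> : (fst_end e == snd_end e) = false by rewrite -val_eqE ltn_eqF.
rewrite (eq_sym l) (eq_sym l).
have [el|_] := eqVneq (fst_end e) l; have [sl|_] := eqVneq (snd_end e) l;
  rewrite ?addr0 ?add0r //.
by rewrite el sl ltnn in lt_e.
Qed.

(** The discrete derivative of the indicator of the arc: it jumps up after the first end of [h] and
    down after the second. *)
Lemma arc_increment h i :
  (fst_end h < ordS i <= snd_end h)%N%:R - (fst_end h < i <= snd_end h)%N%:R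
  = (i == fst_end h)%:R - (i == snd_end h)%:R :> R.
Proof.
have lt_h := fst_lt_snd h; have lt_n := ltn_ord (snd_end h).
rewrite -!val_eqE /=.
have [iE|ine] := eqVneq (i : nat) (fst_end h);
have [jE|jne] := eqVneq (i : nat) (snd_end h).
- by lia.
- have -> : (fst_end h < ordS i <= snd_end h)%N.
    by case: (ordS_val i) => -[? ->]; lia.
  have -> : (fst_end h < i <= snd_end h)%N = false by lia.
  by [].
- have -> : (fst_end h < ordS i <= snd_end h)%N = false.
    by case: (ordS_val i) => -[? ->]; lia.
  by have -> : (fst_end h < i <= snd_end h)%N by lia.
have -> : (fst_end h < ordS i <= snd_end h)%N = (fst_end h < i <= snd_end h)%N.
  by case: (ordS_val i) => -[? ->]; lia.
by rewrite !subrr.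
Qed.

(** For bits x, y the exclusive or is x + y - 2xy. The mixed second difference removes the linear
    part and leaves -2 times the product of the increments. *)
Lemma s_form_W h i j : s_form i j (W_vec R h) =
  - 2 * ((i == fst_end h)%:R - (i == snd_end h)%:R)
      * ((j == fst_end h)%:R - (j == snd_end h)%:R).
Proof.
rewrite -!arc_increment /s_form !entry_W.
by do 4!case: (_ < _ <= _)%N => /=; ring.
Qed.

Lemma s_form_W0 h i j : [set i; j] != ends h -> i != j ->
  s_form i j (W_vec R h) = 0.
Proof.
move=> ijh ij; rewrite s_form_W.
have lt_h := fst_lt_snd h.
have [iE|ine] := eqVneq i (fst_end h); have [iE'|ine'] := eqVneq i (snd_end h);
have [jE|jne] := eqVneq j (fst_end h); have [jE'|jne'] := eqVneq j (snd_end h);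
  subst; rewrite ?eqxx // in ij ijh *; rewrite ?subrr ?mulr0 ?mul0r //.
by rewrite setUC eqxx in ijh.
Qed.

Lemma s_edge_W h e : s_edge e (W_vec R h) = 2 * (e == h)%:R.
Proof.
have [->|eh] := eqVneq e h.
  rewrite /s_edge s_form_W !eqxx.
  have ne : (fst_end h == snd_end h) = false.
    by rewrite -val_eqE ltn_eqF ?fst_lt_snd.
  by rewrite ne [snd_end h == _]eq_sym ne /=; ring.
rewrite mulr0; apply: s_form_W0; first by rewrite (inj_eq (@ends_inj n)).
exact: (@ends_neq n e).
Qed.

(** Distance above one keeps all four entries of [s_form] off the diagonal, where [entry] is a
    dummy. *)
Lemma cdist_gt1 i j : (1 < cdist i j)%N ->
  [/\ i != j, ordS i != ordS j, i != ordS j & ordS i != j].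
Proof.
move=> ij; have n_gt1 : (1 < n)%N.
  by have := gap_ltn i j; move: ij; rewrite /cdist; lia.
have jE := shift_gap i j; have g_n := gap_ltn i j.
have ne : i != j.
  by apply/eqP=> ij_eq; move: ij; rewrite ij_eq /cdist gap0.
have sym := gap_sym ne; have g1 : (1 < gap i j)%N by move: ij; rewrite /cdist; lia.
have g2 : (gap i j < n.-1)%N by move: ij; rewrite /cdist; lia.
split=> //; rewrite -jE -?shiftS; apply/eqP.
- by move/(@shift_inj n i 1 (gap i j).+1); lia.
- by move/(@shift_inj n i 0 (gap i j).+1); lia.
by move/(@shift_inj n i 1 (gap i j)); lia.
Qed.

Lemma s_form_star l i j : (1 < cdist i j)%N -> s_form i j (star_vec R l) = 0.
Proof.
case/cdist_gt1=> n1 n2 n3 n4; rewrite /s_form !entry_star.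
by rewrite (negPf n1) (negPf n2) (negPf n3) (negPf n4); ring.
Qed.

Lemma short_entry0 k h a p q : (edist h <= k)%N -> (p < q)%N -> (q < n)%N ->
    (k < q - p)%N -> (q - p < n - k)%N ->
  entry (basis_vec R h) (shift a p) (shift a q) = 0.
Proof.
move=> hk pq qn gt lt; rewrite entry_basis; case: eqP => // /esym/edist_ends.
by rewrite cdist_shift //; lia.
Qed.

(** The edges in the two sums have gaps [g] and [g+1], and the bounds make them longer than [k] in
    both directions; only the closing edge from [a+m] to [a+g] can be [h]. *)
Lemma cyc_form_basis k h a g m : (edist h <= k)%N -> (m <= k)%N ->
    (k < g)%N -> (g + k.+2 <= n)%N ->
  cyc_form a g m (basis_vec R h) = - ([set shift a m; shift a g] == ends h)%:R.
Proof.
move=> hk mk kg gn; rewrite /cyc_form entry_basis.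
rewrite !big1 ?subr0 ?sub0r // => t _; have lt_t := ltn_ord t;
  by apply: (short_entry0 _ hk); lia.
Qed.

Lemma neq_val i j : i != j -> i != j :> nat.
Proof. by rewrite -val_eqE. Qed.

Lemma FP_s_form_ge0 v i j : FP v -> (1 < cdist i j)%N -> 0 <= s_form i j v.
Proof.
move=> FPv; wlog lt_ij : i j / (i < j)%N.
  move=> wl ij; have [n1 _ _ _] := cdist_gt1 ij.
  move: n1; rewrite -val_eqE neq_ltn => /orP[] lt; first exact: wl.
  by rewrite s_form_sym; apply: wl; rewrite // cdistC.
move=> ij; have [_ _ n3 n4] := cdist_gt1 ij.
have lt_j := ltn_ord j.
case: (ordS_val i) => -[i1 iE]; last by lia.
have lt2 : (ordS i < j)%N.
  by have := neq_val n4; rewrite iE; lia.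
(* Without wrap-around the inequality for i < i+1 < j < j+1 applies. If [j] is the last point, its
   successor is 0 and the increasing quadruple is 0 < i < i+1 < j, so the other term of the maximum
   is used. *)
rewrite /s_form; case: (ordS_val j) => -[j1 jE].
  have := FPv i (ordS i) j (ordS j); rewrite iE jE => /(_ (ltnSn _)).
  rewrite -{1}iE => /(_ lt2 (ltnSn _)); rewrite ge_max => /andP[_].
  lra.
have j0 : (ordS j < i)%N.
  by have := neq_val n3; rewrite jE; lia.
have := FPv (ordS j) i (ordS i) j; rewrite iE => /(_ j0 (ltnSn _)).
rewrite -{1}iE => /(_ lt2); rewrite ge_max => /andP[+ _].
rewrite (entry_sym _ (ordS j) i) (entry_sym _ (ordS j) (ordS i)); lra.
Qed.

Lemma W_FP h : FP (W_vec R h).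
Proof.
move=> a a' b b' aa' a'b bb'; rewrite !entry_W ge_max -!natrD !ler_nat.
by apply/andP; split; lia.
Qed.

Lemma weight_linear E : linear (fun v : vec => weight v E : R^o).
Proof.
move=> c u v; rewrite /weight scaler_sumr -big_split /=.
by apply: eq_bigr => e _; rewrite !ffunE.
Qed.

(** A matching of [U] covers each point of [U] once, so star vectors cannot distinguish two
    matchings of the same set. *)
Lemma weight_star U E l : perfect_matching U E ->
  weight (star_vec R l) E = (l \in U)%:R.
Proof.
move=> UE; rewrite /weight; transitivity (\sum_(x in U) (x == l)%:R : R).
  rewrite (sum_over_matching _ UE); apply: eq_bigr => e _.
  have := entry_star l (fst_end e) (snd_end e); rewrite (@entry_ends _ _ _ e) //.
  by rewrite -val_eqE ltn_eqF ?fst_lt_snd.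
rewrite big_mkcond (bigD1 l) //= eqxx big1 ?addr0; first by case: (l \in U).
by move=> x /negPf->; case: ifP.
Qed.

Lemma weight_basis h E : weight (basis_vec R h) E = (h \in E)%:R.
Proof.
rewrite /weight big_mkcond (bigD1 h) //= ffunE eqxx big1 ?addr0.
  by case: (h \in E).
by move=> x /negPf xh; rewrite ffunE xh; case: ifP.
Qed.

(* Writing S for the cut, an edge of a crossing inside S and one outside S
   would not cross; so the crossing cuts as many edges as min(|S|, |U - S|)
   allows. *)
Lemma weight_W_crossing k U X E h : perfect_matching U X ->
    is_crossing k.+1 X -> perfect_matching U E ->
  weight (W_vec R h) E <= weight (W_vec R h) X.
Proof.
move=> UX [_ crX] UE; pose S (z : 'I_n) := (fst_end h < z <= snd_end h)%N.
pose cut (F : {set edge n}) := (\sum_(e in F) (S (fst_end e) != S (snd_end e)))%N.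
have weightE F : weight (W_vec R h) F = (cut F)%:R.
  rewrite /weight /cut natr_sum; apply: eq_bigr => e _.
  by rewrite ffunE !in_arc.
rewrite !weightE ler_nat.
pose inside (F : {set edge n}) := (\sum_(e in F) (S (fst_end e) && S (snd_end e)))%N.
pose outside (F : {set edge n}) :=
  (\sum_(e in F) (~~ S (fst_end e) && ~~ S (snd_end e)))%N.
have insE F : perfect_matching U F ->
    #|[set z in U | S z]| = (cut F + 2 * inside F)%N.
  move=> UF; rewrite (card_over_matching _ UF) /cut /inside big_distrr /=.
  rewrite -big_split /=; apply: eq_bigr => e _.
  by do 2!case: (S _).
have outE F : perfect_matching U F ->
    #|[set z in U | ~~ S z]| = (cut F + 2 * outside F)%N.
  move=> UF; rewrite (card_over_matching _ UF) /cut /outside big_distrr /=.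
  rewrite -big_split /=; apply: eq_bigr => e _.
  by do 2!case: (S _).
have := insE _ UX; have := outE _ UX; rewrite (insE _ UE) (outE _ UE).
suff [-> | ->] : inside X = 0%N \/ outside X = 0%N by lia.
case: (boolP [exists e in X, S (fst_end e) && S (snd_end e)]) => [/exists_inP|].
  case=> e eX /andP[Se1 Se2]; right; apply: big1 => f fX; apply/eqP.
  rewrite eqb0; apply/negP=> /andP[Sf1 Sf2].
  have ef : e != f by apply: contraNneq Sf1 => <-.
  have := crX _ _ eX fX ef; move: Se1 Se2 Sf1 Sf2; rewrite /S /crosses; lia.
rewrite negb_exists_in => /forall_inP noS; left; apply: big1 => f fX.
by rewrite (negPf (noS _ fX)).
Qed.

End Generators.

(** * The lineality space and its dimension *)

Section Lines.
Variables (R : realFieldType) (n : nat).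
Local Notation vec := {ffun edge n -> R^o}.

Lemma linear_vanish_span (V : vectType R) (X : seq V) (f : V -> R^o) :
  linear f -> {in X, forall x, f x = 0} ->
  forall v, v \in <<X>>%VS -> f v = 0.
Proof.
move=> lf fX v.
pose Li := GRing.isLinear.Build R V R^o _ f lf.
pose fl : {linear V -> R^o} := HB.pack f Li.
suff /subvP sub : (<<X>> <= lker (linfun fl))%VS.
  by move/sub; rewrite memv_ker lfunE => /eqP.
by apply/span_subvP=> x xX; rewrite memv_ker lfunE /=; apply/eqP/fX.
Qed.

Lemma Grob_lines_vanish (f : vec -> R^o) : linear f ->
  (forall l, f (star_vec R l) = 0) ->
  forall v, v \in <<Grob_lines R n>>%VS -> f v = 0.
Proof.
move=> lf f0; apply: linear_vanish_span => // x.
by case/mapP=> l _ ->.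
Qed.

(** A vanishing combination has c_a + c_b = 0 on every edge; the three edges among i, i+1, i+2,
    distinct since [2 < n], force c_i = 0. *)
Lemma dim_Grob_lines : (2 < n)%N -> \dim <<Grob_lines R n>> = n.
Proof.
move=> n_gt2; have tE : Grob_lines R n = [tuple star_vec R i | i < n].
  by [].
suff : free [tuple star_vec R i | i < n].
  by rewrite tE /free size_tuple => /eqP.
apply/freeP=> c c0 i.
have pairE a b : a != b -> c a + c b = 0.
  move=> ab; have d : edge n.
    exact: default_edge (ltnW n_gt2).
  have /ffunP/(_ (mkedge d a b)) := c0; rewrite sum_ffunE ffunE => <-.
  rewrite (bigD1 a) //= (bigD1 b) 1?eq_sym //= big1 => [|l /andP[la lb]].
    by rewrite !ffunE !nth_mktuple !ffunE (ends_mkedge d ab) !inE !eqxx orbT addr0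
      /GRing.scale /= !mulr1.
  by rewrite ffunE nth_mktuple ffunE (ends_mkedge d ab) !inE (negPf la) (negPf lb)
    scaler0.
have s0 : shift i 0 = i by [].
have n01 : i != shift i 1 by rewrite -{1}s0; apply/eqP=> /shift_inj; lia.
have n02 : i != shift i 2 by rewrite -{1}s0; apply/eqP=> /shift_inj; lia.
have n12 : shift i 1 != shift i 2 by apply/eqP=> /shift_inj; lia.
by have := pairE _ _ n01; have := pairE _ _ n02; have := pairE _ _ n12; lra.
Qed.

Lemma dim_vec : \dim {: vec} = 'C(n, 2).
Proof. by rewrite dimvf -card_edge /dim /= muln1. Qed.

End Lines.

(** * Counting edges by cyclic distance *)

Section Counting.
Variable n : nat.
Implicit Types e : edge n.

(** For [2d < n] each edge of distance [d] has exactly one starting point [i] with other end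
    [i + d]. *)
Lemma card_edist d : (0 < d)%N -> (2 * d < n)%N ->
  #|[set e : edge n | edist e == d]| = n.
Proof.
move=> d0 dn; have d1 : edge n.
  have n_gt1 : (1 < n)%N by lia.
  exact: default_edge n_gt1.
pose h (i : 'I_n) := mkedge d1 i (shift i d).
have gE (i : 'I_n) : gap i (shift i d) = d.
  by have := gap_shift i (leq0n d); rewrite /= subn0; apply; lia.
have hE (i : 'I_n) : ends (h i) = [set i; shift i d].
  rewrite ends_mkedge //; apply/eqP=> ij; have := gE i; rewrite -ij gap0; lia.
have h_inj : injective h.
  move=> i j ij; have := hE j; rewrite -ij => hj.
  by case: (short_orientation_unique (hE i) hj); rewrite ?gE.
rewrite -[RHS]card_ord -(card_imset _ h_inj); apply: eq_card => e.
rewrite inE; apply/eqP/imsetP=> [ed|[i _ ->]].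
  have [i [j [eij gij _]]] := short_orientation e.
  exists i => //; apply/esym/mkedge_ends.
  by rewrite -ed -gij shift_gap.
by rewrite (edist_gap (hE i)) gE.
Qed.

Lemma mem_filter_edges (P : pred (edge n)) e :
  (e \in [seq f <- enum {: edge n} | P f]) = P e.
Proof. by rewrite mem_filter mem_enum andbT. Qed.

Lemma edist_gt0 e : (0 < edist e)%N.
Proof.
have lt_e := fst_lt_snd e; have := ltn_ord (snd_end e).
rewrite /edist /cdist.
by case: (gap_cases (fst_end e) (snd_end e)) => -[? ->];
  case: (gap_cases (snd_end e) (fst_end e)) => -[? ->]; lia.
Qed.

(** Used with [d = 1] for the inequalities and [d = k+1] for the generators, which are therefore
    equally many. *)
Lemma count_edges_except d : (0 < d)%N -> (2 * d < n)%N ->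
  #|[set e : edge n | edist e != d]| = ('C(n, 2) - n)%N.
Proof.
move=> d0 dn; have := cardC [set e : edge n | edist e == d].
rewrite (card_edist d0 dn) card_edge => <-; rewrite addKn.
by apply: eq_card => e; rewrite !inE.
Qed.

End Counting.

(** * Duality of inequalities and generators, and the description of the cone *)

Section Grob.
Variables (R : realFieldType) (k n : nat).
Local Notation vec := {ffun edge n -> R^o}.
Hypotheses (hk : (1 <= k)%N) (hn : (2 * k + 3 <= n)%N).
Implicit Types (e h : edge n) (v : vec).

Definition ineq_edges : seq (edge n) :=
  [seq e <- enum {: edge n} | (k + 1 <= edist e)%N]
  ++ [seq e <- enum {: edge n} | (2 <= edist e <= k)%N].

Definition ray_edges : seq (edge n) :=
  [seq e <- enum {: edge n} | (1 <= edist e <= k)%N]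
  ++ [seq e <- enum {: edge n} | (k + 2 <= edist e)%N].

Definition ineq_form e : vec -> R^o :=
  if (k + 1 <= edist e)%N then s_edge e else short_form k e.

Definition ray_vec e : vec :=
  if (edist e <= k)%N then - basis_vec R e else W_vec R e.

(** Distances from [k+2] on are kept, while the distances 2, ..., k+1 drop by one to 1, ..., k. The
    edges labelling inequalities are thus matched with those labelling generators. *)
Definition dual_edge e : edge n := if (k + 2 <= edist e)%N then e else inner e.

Lemma ineq_formsE : map ineq_form ineq_edges = Grob_ineqs R n k.
Proof.
rewrite map_cat; congr (_ ++ _); apply/eq_in_map=> e;
  rewrite mem_filter_edges /ineq_form => d_e; first by rewrite d_e.
by rewrite ifN //; lia.
Qed.

Lemma ray_vecsE : map ray_vec ray_edges = Grob_rays R n k.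
Proof.
rewrite map_cat; congr (_ ++ _); apply/eq_in_map=> e;
  rewrite mem_filter_edges /ray_vec => d_e.
  by case/andP: d_e => _ ->.
by rewrite ifN //; lia.
Qed.

Lemma mem_ineq_edges e : (e \in ineq_edges) = (1 < edist e)%N.
Proof.
by rewrite mem_cat !mem_filter_edges; lia.
Qed.

Lemma mem_ray_edges e : (e \in ray_edges) = (edist e != k.+1).
Proof.
by have := edist_gt0 e; rewrite mem_cat !mem_filter_edges; lia.
Qed.

Lemma uniq_ineq_edges : uniq ineq_edges.
Proof.
rewrite cat_uniq; apply/and3P; split; try exact/filter_uniq/enum_uniq.
apply/hasPn=> e /=.
by rewrite !mem_filter_edges => d_e; apply/negP=> ?; lia.
Qed.

Lemma uniq_ray_edges : uniq ray_edges.
Proof.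
rewrite cat_uniq; apply/and3P; split; try exact/filter_uniq/enum_uniq.
apply/hasPn=> e /=.
by rewrite !mem_filter_edges => d_e; apply/negP=> ?; lia.
Qed.

Lemma size_ineq_edges : size ineq_edges = ('C(n, 2) - n)%N.
Proof.
rewrite -(card_uniqP uniq_ineq_edges) -(@count_edges_except n 1) //; last by lia.
by apply: eq_card => e; rewrite mem_ineq_edges inE; have := edist_gt0 e; lia.
Qed.

Lemma size_ray_edges : size ray_edges = ('C(n, 2) - n)%N.
Proof.
rewrite -(card_uniqP uniq_ray_edges) -(@count_edges_except n k.+1) //; last by lia.
by apply: eq_card => e; rewrite mem_ray_edges inE.
Qed.

Lemma ineq_form_cyc e : (1 < edist e <= k + 1)%N ->
  exists a m, [/\ (0 < m <= k)%N,
    ends e = [set shift a m.-1; shift a k.+1],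
    (2 * gap (shift a m.-1) (shift a k.+1) < n)%N,
    ends (inner e) = [set shift a m; shift a k.+1]
    & ineq_form e =1 cyc_form a k.+1 m].
Proof.
move=> e_low; have [a [m [hm em eE]]] := anchored_edge hn e_low.
have gE : gap (shift a m.-1) (shift a k.+1) = edist e by rewrite gap_shift; lia.
exists a, m; split=> //; first by rewrite gE; lia.
  rewrite (inner_ends eE) -?shiftS ?prednK ?gE //; lia.
move=> v; rewrite -(short_form_cyc hn hm eE) /ineq_form.
(* At distance exactly [k+1] the inequality is a long one, but then [m = 1] and the triangle reduces
   to that single term. *)
case: ifP => // d_e; have m1 : m = 1%N by lia.
rewrite (short_form_cyc hn hm eE) (s_edge_ends _ eE) m1 -s_form_cyc.
by [].
Qed.

Lemma ineq_form_linear e : linear (ineq_form e).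
Proof.
rewrite /ineq_form; case: ifP => _; first exact: s_edge_linear.
exact: short_form_linear.
Qed.

Lemma ineq_form_high e : (k + 2 <= edist e)%N -> exists a g,
  [/\ (k.+1 < g)%N, (g + k.+2 <= n)%N, ends e = [set a; shift a g]
    & ineq_form e =1 cyc_form a g 1].
Proof.
move=> e_high; pose a := fst_end e; pose g := gap a (snd_end e).
have sE : snd_end e = shift a g by rewrite shift_gap.
have ne : a != snd_end e by exact: (@ends_neq n e).
have sym := gap_sym ne.
exists a, g; split.
- by move: e_high; rewrite /edist /cdist /g /a; lia.
- by move: e_high; rewrite /edist /cdist; move: sym; rewrite /g /a; lia.
- by rewrite -sE.
move=> v; rewrite /ineq_form ifT; last by lia.
by rewrite /s_edge sE s_form_cyc.
Qed.

Lemma inner_edist e : (1 < edist e <= k + 1)%N -> (edist (inner e)).+1 = edist e.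
Proof.
move=> e_low; have [a [m [hm eE sh inE _]]] := ineq_form_cyc e_low.
rewrite (edist_ends inE) (edist_ends eE) !cdist_shift; lia.
Qed.

(** All terms of the triangle belong to edges of distance at most [k+1], hence different from
    [h]. *)
Lemma cyc_form_W0 h a m : (k + 2 <= edist h)%N -> (m <= k)%N ->
  cyc_form a k.+1 m (W_vec R h) = 0.
Proof.
move=> h_high mk; rewrite cyc_form_triangle; apply: big1 => p _; apply: big1 => q _.
have lt_p := ltn_ord p; have lt_q := ltn_ord q.
apply: s_form_W0; last by apply/eqP=> /shift_inj; lia.
apply/eqP=> /esym/edist_ends dE.
by move: h_high; rewrite dE cdist_shift; lia.
Qed.

Lemma ineq_form_star e l : (1 < edist e)%N -> ineq_form e (star_vec R l) = 0.
Proof.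
move=> e_gt1; have [e_low|e_high] := leqP (edist e) (k + 1); last first.
  by rewrite /ineq_form ifT; [exact: s_form_star | lia].
have e_low' : (1 < edist e <= k + 1)%N by rewrite e_gt1.
have [a [m [hm _ _ _ ->]]] := ineq_form_cyc e_low'.
rewrite cyc_form_triangle; apply: big1 => p _; apply: big1 => q _.
have lt_p := ltn_ord p; have lt_q := ltn_ord q.
by apply: s_form_star; rewrite cdist_shift; lia.
Qed.

Lemma ineq_form_ray e h : (1 < edist e)%N -> edist h != k.+1 ->
  ineq_form e (ray_vec h) =
  (if (k + 2 <= edist e)%N then 2 else 1) * (h == dual_edge e)%:R.
Proof.
move=> e_gt1 h_ne; have lin := ineq_form_linear e.
rewrite /dual_edge; case: ifP => e_high.
  rewrite /ray_vec; case: ifP => h_low; last first.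
    by rewrite /ineq_form ifT ?s_edge_W 1?eq_sym //; lia.
  have [a [g [g1 g2 eE fE]]] := ineq_form_high e_high.
  rewrite linear_formN // fE (cyc_form_basis _ _ h_low) //; last exact: ltnW.
  rewrite opprK; have -> : (h == e) = false.
    by apply/eqP=> he; move: h_low e_high; rewrite he; lia.
  (* The closing edge from [a+1] to [a+g] has distance above [k] because [g > k+1], so it is not the
     short edge [h]. *)
  rewrite mulr0; case: eqP => // /esym/edist_ends dh.
  by move: h_low; rewrite dh cdist_shift; lia.
have e_low : (1 < edist e <= k + 1)%N by lia.
have [a [m [hm eE sh inE fE]]] := ineq_form_cyc e_low.
have dE := inner_edist e_low.
rewrite mul1r /ray_vec; case: ifP => h_low.
  rewrite linear_formN // fE (cyc_form_basis _ _ h_low) //; try lia.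
  by rewrite opprK -inE (inj_eq (@ends_inj n)) eq_sym.
rewrite fE cyc_form_W0; try lia.
by have -> : (h == inner e) = false by apply/eqP=> he; move: h_low; rewrite he; lia.
Qed.

(** The distance of the image separates the two branches. On the lower one the inner edge keeps its
    short orientation, so moving its first end back by one recovers the edge. *)
Lemma dual_edge_inj : {in ineq_edges &, injective dual_edge}.
Proof.
move=> e f; rewrite !mem_ineq_edges => e1 f1; rewrite /dual_edge.
case: ifP => eh; case: ifP => fh // ef.
- have f_low : (1 < edist f <= k + 1)%N by lia.
  have := inner_edist f_low; rewrite -ef; lia.
- have e_low : (1 < edist e <= k + 1)%N by lia.
  have := inner_edist e_low; rewrite ef; lia.
have e_low : (1 < edist e <= k + 1)%N by lia.
have f_low : (1 < edist f <= k + 1)%N by lia.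
have [a [m [hm eE _ inE _]]] := ineq_form_cyc e_low.
have [b [p [hp fE _ inF _]]] := ineq_form_cyc f_low.
rewrite -ef in inF.
have [] := short_orientation_unique inE inF; [by rewrite gap_shift; lia..|].
case: m p hm hp eE fE {inE inF} => [|m] [|p] //= hm hp eE fE.
move=> ordS_eq jE; apply: ends_inj; rewrite eE fE jE.
by rewrite (@shift_base_inj n 1 (shift a m) (shift b p) ordS_eq).
Qed.

Definition satisfies_ineqs v : Prop := {in ineq_edges, forall e, 0 <= ineq_form e v}.

(** Stated for any [C] cut out by the inequalities: applied to the inequality cone itself it
    supplies the generators used in [ineqs_sub_Grob], and afterwards it applies to [Grob]. *)
Lemma ineqs_cone C : (forall v, C v <-> satisfies_ineqs v) ->
  simplicial_cone C <<Grob_lines R n>>%VS (Grob_rays R n k)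
  /\ irredundant_facet_description C (Grob_ineqs R n k).
Proof.
move=> CE; rewrite -ray_vecsE -ineq_formsE.
apply: (labelled_dual_cone (s := dual_edge)) => //.
- by move=> e _; apply: ineq_form_linear.
- move=> e; rewrite mem_ineq_edges => e1; apply: Grob_lines_vanish.
    exact: ineq_form_linear.
  by move=> l; apply: ineq_form_star.
- rewrite dim_Grob_lines ?dim_vec ?size_ineq_edges ?subnKC //; try lia.
  (* The truncated subtraction needs n <= C(n,2), which holds because [n] edges have distance 1. *)
  have := max_card (mem [set e : edge n | edist e == 1%N]).
  by rewrite card_edge card_edist //; lia.
- exact: uniq_ineq_edges.
- exact: uniq_ray_edges.
- by rewrite size_ineq_edges size_ray_edges.
- move=> e; rewrite mem_ineq_edges mem_ray_edges /dual_edge => e1.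
  by case: ifP => eh; [lia | have := @inner_edist e; lia].
- exact: dual_edge_inj.
- move=> e h; rewrite mem_ineq_edges mem_ray_edges => e1 h1 /negPf he.
  by rewrite ineq_form_ray // he mulr0.
move=> e; rewrite mem_ineq_edges => e1; rewrite ineq_form_ray //.
  by rewrite eqxx mulr1; case: ifP.
rewrite /dual_edge; case: ifP => eh; [lia | have := @inner_edist e; lia].
Qed.

Lemma Grob_sub_ineqs v : Grob k v -> satisfies_ineqs v.
Proof.
move=> Gv e; rewrite mem_ineq_edges => e1.
have [e_low|e_high] := leqP (edist e) (k + 1).
  have e_low' : (1 < edist e <= k + 1)%N by rewrite e1.
  have [a [m [hm _ _ _ ->]]] := ineq_form_cyc e_low'.
  by apply: Grob_cyc_form_ge0 Gv _ _ _; lia.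
have [|a [g [g1 g2 _ ->]]] := @ineq_form_high e; first by lia.
by apply: Grob_cyc_form_ge0 Gv _ _ _; lia.
Qed.

(** For a crossing [X] and a rival matching [E], the weight difference is linear, vanishes on the
    lines and is nonnegative on each generator, hence on the whole cone. *)
Lemma ineqs_sub_Grob v : satisfies_ineqs v -> Grob k v.
Proof.
move=> Hv; have [[_ _ gen] _] := ineqs_cone (fun=> iff_refl _).
have [l lL [c [c_ge0 vl]]] := (gen v).1 Hv.
move=> U cU; have [X UX cX] := crossing_exists cU.
exists X; split=> // E UE; rewrite -subr_ge0.
pose D w : R^o := weight w X - weight w E.
have linD : linear D.
  by move=> a x y; rewrite /D !weight_linear /GRing.scale /=; ring.
have Dl : D l = 0.
  apply: (Grob_lines_vanish linD _ lL) => i.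
  by rewrite /D (weight_star _ _ UX) (weight_star _ _ UE) subrr.
pose Li := GRing.isLinear.Build R vec R^o _ D linD.
pose DL : {linear vec -> R^o} := HB.pack D Li.
have DLl : DL l = 0 := Dl.
rewrite -/(D v) -[v](subrK l) vl -[D _]/(DL _) linearD DLl addr0.
rewrite linear_sum; apply: sumr_ge0 => i _; rewrite linearZ; apply: mulr_ge0 => //.
have : (Grob_rays R n k)`_i \in map ray_vec ray_edges by rewrite ray_vecsE mem_nth.
case/mapP=> h; rewrite mem_ray_edges => h_ne ->.
rewrite /= /ray_vec; case: ifP => h_low.
  (* The crossing contains no edge of distance at most [k], so only [E] can lose weight from
     [- basis_vec R h]. *)
  rewrite /D !(linear_formN _ (@weight_linear _ _ _)) !weight_basis.
  have -> : h \in X = false.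
    by apply/negP=> /(crossing_edist cU UX cX); lia.
  by rewrite oppr0 sub0r opprK.
by rewrite /D subr_ge0; apply: weight_W_crossing UX cX UE.
Qed.

Lemma GrobE v : Grob k v <-> satisfies_ineqs v.
Proof. by split; [apply: Grob_sub_ineqs | apply: ineqs_sub_Grob]. Qed.

(** Every inequality is a sum of forms [s_form i j] at distance above one, each nonnegative on
    [FP]. *)
Lemma FP_sub_Grob v : FP v -> Grob k v.
Proof.
move=> FPv; apply/GrobE=> e; rewrite mem_ineq_edges => e1.
have [e_low|e_high] := leqP (edist e) (k + 1); last first.
  by rewrite /ineq_form ifT; [exact: FP_s_form_ge0 | lia].
have e_low' : (1 < edist e <= k + 1)%N by rewrite e1.
have [a [m [hm _ _ _ ->]]] := ineq_form_cyc e_low'.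
rewrite cyc_form_triangle; apply: sumr_ge0 => p _; apply: sumr_ge0 => q _.
have lt_p := ltn_ord p; have lt_q := ltn_ord q.
by apply: FP_s_form_ge0; rewrite // cdist_shift; lia.
Qed.

Lemma W_FP_ray e : (1 < edist e)%N -> FP_ray e (W_vec R e).
Proof.
move=> e1; split; first exact: W_FP.
  (* The form of [e] takes the value -2 at the negative of [W_vec R e]. *)
  move=> FPN; have : 0 <= s_edge e (- W_vec R e) by exact: FP_s_form_ge0.
  rewrite (linear_formN _ (@s_edge_linear _ _ e)) s_edge_W eqxx mulr1 oppr_ge0.
  by rewrite lern0.
by move=> f _ /negPf fe; rewrite s_edge_W fe mulr0.
Qed.

End Grob.

Theorem theorem1p7 (R : realFieldType) (k n : nat)
    (hk : (1 <= k)%N) (hn : (2 * k + 3 <= n)%N) :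
  [/\ \dim <<Grob_lines R n>> = n
        /\ simplicial_cone (@Grob R n k) <<Grob_lines R n>>%VS (Grob_rays R n k),
      forall e : edge n, (k + 2 <= edist e)%N -> FP_ray e (W_vec R e),
      irredundant_facet_description (@Grob R n k) (Grob_ineqs R n k)
        /\ size (Grob_ineqs R n k) = ('C(n, 2) - n)%N
    & forall v : {ffun edge n -> R^o}, FP v -> Grob k v].
Proof.
have [simp irr] := ineqs_cone hk hn (@GrobE R k n hk hn).
split.
- by split=> //; apply: dim_Grob_lines; lia.
- by move=> e e_high; apply: W_FP_ray; lia.
- split=> //; rewrite -(size_ineq_edges hk hn) -(size_map (@ineq_form R k n)).
  by rewrite ineq_formsE.
by move=> v; apply: FP_sub_Grob.
Qed.
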